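(* For every fixed regular language $L$ over a finite alphabet $\Sigma$, there is an algorithm (in the unit-cost RAM model described in the context) for the out-of-order membership problem for $L$ which, on streams of words of length $n$, uses $O(1)$ time per streamed character and has a space complexity of $O(n)$ bits.
   Context: Problem. Let $w = w[1]\cdots w[n]$ be a word of length $n>0$ over $\Sigma$ and let $\pi$ be a permutation of $\{1,\ldots,n\}$. The out-of-order stream of $w$ defined by $\pi$ is the sequence of triples $(w[\pi(i)],\pi(i),n)$ for $i=1,\ldots,n$. In the out-of-order membership problem for a fixed language $L$, the algorithm receives the triples of the stream one after the other, for an arbitrary $w$ and an arbitrary $\pi$, and must decide at the end of the stream whether $w\in L$. The length $n$ is known. Computational model. Unit-cost RAM with logarithmic word size: memory consists of cells of $\Theta(\log n)$ bits; reading, writing, or performing a standard operation on cells takes constant time. Allowed operations: addition, subtraction, increment, comparisons, integer division with remainder, shifts, bitwise Boolean operations, and computing the most significant bit. Arrays can be allocated and initialized in constant time (lazy array initialization). Each streamed triple $(a,i,n)$ is received in three cells. The time bound is worst-case for each streamed triple, including the last one, after which the answer must be produced; there is no separate preprocessing phase. A space complexity of $O(n)$ bits means $O(n/\log n)$ memory cells. The language $L$ and alphabet $\Sigma$ are fixed, so constants may depend on them. *)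

(* Defs.v *)
From mathcomp Require Import all_boot all_fingroup.

Set Implicit Arguments.
Unset Strict Implicit.
Unset Printing Implicit Defensive.

Record dfa (Sigma : finType) := Dfa {
  dfa_state : finType;
  dfa_start : dfa_state;
  dfa_final : {set dfa_state};
  dfa_trans : dfa_state -> Sigma -> dfa_state }.

Definition dfa_accepts (Sigma : finType) (A : dfa Sigma) (w : seq Sigma) : bool :=
  foldl (@dfa_trans Sigma A) (dfa_start A) w \in dfa_final A.

Definition regular (Sigma : finType) (L : seq Sigma -> Prop) : Prop :=
  exists A : dfa Sigma, forall w, L w <-> dfa_accepts A w.

(* 'I_n is 0-based, whereas stream positions range over {1, ..., n}. *)
Definition out_of_order_stream (Sigma : finType) (n : nat)
    (w : n.-tuple Sigma) (pi : 'S_n) : seq (Sigma * nat * nat) :=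
  [seq (tnth w (pi i), (pi i).+1, n) | i <- enum 'I_n].

(* The unit-cost RAM. There is one memory; its cells hold W-bit words. Cells
   [0, top) are in use: a constant number of static cells, followed by the
   arrays allocated so far. Operands d, a, b of instructions are addresses of
   cells fixed in the program; Get and Put add indirect addressing.
   Multiplication is deliberately not an operation of this model. *)
Inductive unop := OpMov | OpInc | OpNot | OpMsb.

Inductive binop :=
  OpAdd | OpSub | OpDiv | OpMod | OpAnd | OpOr | OpXor | OpShl | OpShr | OpEq | OpLt | OpLe.

Inductive instr :=
  | Const (d k : nat)      (* mem[d] := k *)
  | Un (o : unop) (d a : nat)
  | Bin (o : binop) (d a b : nat)
  | Get (d a : nat)        (* mem[d] := mem[mem[a]] *)
  | Put (d a : nat)        (* mem[mem[d]] := mem[a] *)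
  | Alloc (d a b : nat)    (* mem[d] := address of a new array of mem[a] cells,
                              all initialized to mem[b] *)
  | Jmp (l : nat)
  | Jz (a l : nat)         (* jump to l if mem[a] = 0 *)
  | Halt.

Record program := Program { scratch : nat; code : seq instr }.

Record state := State { cells : nat -> nat; top : nat }.

(* Accessing a cell that is not in use is a fault, represented by None. *)
Definition read (s : state) (x : nat) : option nat :=
  if x < top s then Some (cells s x) else None.

(* All writes truncate to W bits. *)
Definition write (W : nat) (s : state) (x v : nat) : option state :=
  if x < top s then
    Some (State (fun y => if y == x then v %% 2 ^ W else cells s y) (top s))
  else None.

Definition alloc (W : nat) (s : state) (len v : nat) : option state :=
  if top s + len <= 2 ^ W then
    Some (State (fun y => if top s <= y < top s + len then v else cells s y)
                (top s + len))
  else None.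

Definition eval_un (W : nat) (o : unop) (x : nat) : option nat :=
  match o with
  | OpMov => Some x
  | OpInc => Some x.+1
  | OpNot => Some (Nat.lxor x (2 ^ W).-1)
  | OpMsb => if x == 0 then None else Some (trunc_log 2 x)
  end.

(* Results are truncated when written, so arithmetic is modulo 2 ^ W. *)
Definition eval_bin (W : nat) (o : binop) (x y : nat) : option nat :=
  match o with
  | OpAdd => Some (x + y)
  | OpSub => Some (x + 2 ^ W - y)
  | OpDiv => if y == 0 then None else Some (x %/ y)
  | OpMod => if y == 0 then None else Some (x %% y)
  | OpAnd => Some (Nat.land x y)
  | OpOr => Some (Nat.lor x y)
  | OpXor => Some (Nat.lxor x y)
  | OpShl => Some (x * 2 ^ y)
  | OpShr => Some (x %/ 2 ^ y)
  | OpEq => Some (nat_of_bool (x == y))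
  | OpLt => Some (nat_of_bool (x < y))
  | OpLe => Some (nat_of_bool (x <= y))
  end.

(* Control instructions are interpreted by run, not by exec. *)
Definition exec (W : nat) (i : instr) (s : state) : option state :=
  match i with
  | Const d k => write W s d k
  | Un o d a =>
      obind (fun x =>
      obind (write W s d) (eval_un W o x)) (read s a)
  | Bin o d a b =>
      obind (fun x => obind (fun y =>
      obind (write W s d) (eval_bin W o x y)) (read s b)) (read s a)
  | Get d a =>
      obind (fun p => obind (write W s d) (read s p)) (read s a)
  | Put d a =>
      obind (fun p => obind (write W s p) (read s a)) (read s d)
  | Alloc d a b =>
      obind (fun len => obind (fun v =>
      obind (fun s' => alloc W s' len v) (write W s d (top s)))
        (read s b)) (read s a)
  | _ => None
  end.

(* run W p t pc s = Some s' iff execution of p from instruction pc in state s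
   halts without a fault, in state s', after at most t instructions. *)
Fixpoint run (W : nat) (p : seq instr) (t pc : nat) (s : state) : option state :=
  if t is t'.+1 then
    match onth p pc with
    | Some Halt => Some s
    | Some (Jmp l) => run W p t' l s
    | Some (Jz a l) =>
        obind (fun x => run W p t' (if x == 0 then l else pc.+1) s) (read s a)
    | Some i => obind (run W p t' pc.+1) (exec W i s)
    | None => None
    end
  else None.

(* Cells 0, 1, 2 receive the streamed triples; cell 0 also holds the answer.
   There is no preprocessing: the memory is initially all zero. *)
Definition init (P : program) : state := State (fun=> 0) (3 + scratch P).

Definition receive (W : nat) (Sigma : finType) (x : Sigma * nat * nat)
    (s : state) : option state :=
  let: (a, i, n) := x in
  obind (fun s1 => obind (fun s2 => write W s2 2 n) (write W s1 1 i))
    (write W s 0 (enum_rank a)).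

(* The program is run once, from its first instruction and for at most T
   steps, on each streamed triple; only the memory persists in between. *)
Definition run_stream (W : nat) (P : program) (T : nat) (Sigma : finType)
    (xs : seq (Sigma * nat * nat)) : option state :=
  foldl (fun os x =>
           obind (run W (code P) T 0) (obind (receive W x) os))
        (Some (init P)) xs.

Definition answer (s : state) : bool := cells s 0 != 0.

(* Cells are never released, so at the end of a run top is the number of cells
   used during the whole run. *)
Definition space_bits (W : nat) (s : state) : nat := top s * W.

(* Cells have Theta(log n) bits; .+1 makes the width positive at n = 1. *)
Definition word_size (c n : nat) : nat := c * (trunc_log 2 n).+1.

(* Main.v *)
Require Import Defs.
From mathcomp Require Import all_boot all_fingroup.
From mathcomp Require Import zify.

(* Words are mapped to the transition monoid of the automaton. If every maximal
   run of known positions carries its monoid element, a new letter merges the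
   run on its left, itself and the run on its right with two products.

   A table of run lengths for all positions would need n log n bits, so the word
   is cut into blocks of B = log n + 1 positions. Inside a block the known
   positions form a bit mask, kept also in reverse, so that the two neighbouring
   gaps are found by a most significant bit each; the element of the run starting
   at offset j is the j-th digit of one machine word. A table of run lengths is
   used only for runs of full blocks, of which there are n / log n.

   Both levels are instances of one picture: a set of "gaps" (unknown positions,
   or blocks that are not full, together with two sentinels), in which values are
   attached to pairs of consecutive gaps, and from which one gap is removed. *)

Set Implicit Arguments.
Unset Strict Implicit.
Unset Printing Implicit Defensive.

(** * A small expression language on top of the RAM *)

(** Hence stored values are never erased. Each is keyed by the gaps that delimit its run; when a gap
    [t] between neighbours [l] and [r] disappears, (l, r) is the only new pair of consecutive gaps,
    and every other remaining pair has neither left end [l] nor right end [r]. Overwriting what is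
    keyed by [l] and [r] restores the invariant; entries inside the merged run go stale, but the
    invariant no longer speaks of them. Hence also zero-filled memory must be a valid state: the
    masks record known positions rather than gaps, lengths start at 0, and 0 codes the identity of
    the monoid. The tables for products, letters and acceptance have constant size and are simply
    rewritten at every triple. The base [D] of the digits depends on the language only, so [B.+1]
    digits take O(log n) bits and fit in one cell once the factor [c] of the word size is large
    enough. *)

Fixpoint execs (W : nat) (c : seq instr) (s : state) : option state :=
  if c is i :: c' then obind (execs W c') (exec W i s) else Some s.

Lemma execs_cat W c1 c2 s :
  execs W (c1 ++ c2) s = obind (execs W c2) (execs W c1 s).
Proof. by elim: c1 s => //= i c1 IH s; case: (exec W i s). Qed.

(** [exec] fails on control instructions, so success of [execs] already certifies that [c] is
    straight-line code. *)
Lemma run_execs W pre c post t s s' :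
  execs W c s = Some s' ->
  run W (pre ++ c ++ post) (size c + t) (size pre) s =
  run W (pre ++ c ++ post) t (size (pre ++ c)) s'.
Proof.
elim: c pre s => [|i c IH] pre s /=; first by case=> ->; rewrite cats0 add0n.
case Ei: (exec W i s) => [s1|] //= E.
have -> : onth (pre ++ i :: c ++ post) (size pre) = Some i.
  by rewrite onthE map_cat nth_cat size_map ltnn subnn.
have /= := IH (rcons pre i) s1 E.
rewrite !cat_rcons size_rcons => IH1.
by case: i Ei IH1 => //= [d k|o d a|o d a b|d a|d a|d a b] -> /= ->.
Qed.

Lemma run_jz W p t pc a l s v : onth p pc = Some (Jz a l) -> read s a = Some v ->
  run W p t.+1 pc s = run W p t (if v == 0 then l else pc.+1) s.
Proof. by move=> /= -> ->. Qed.

Lemma run_halt W p t pc s : onth p pc = Some Halt -> run W p t.+1 pc s = Some s.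
Proof. by move=> /= ->. Qed.

(** Cells 0 to 31 are the inputs, the persistent total and the [Let]-bound values; the remaining
    sixteen leave room for the evaluation stack. *)
Definition regs := 48.

Inductive expr :=
  | Reg of nat
  | Cst of nat
  | Op1 of unop & expr
  | Op2 of binop & expr & expr
  | Fetch of expr.

Inductive stmt :=
  | Let of expr
  | Assign of nat & expr
  | Store of expr & expr
  | New of expr.

Fixpoint depth (e : expr) : nat :=
  match e with
  | Reg _ | Cst _ => 1
  | Op1 _ e | Fetch e => depth e
  | Op2 _ e1 e2 => maxn (depth e1) (depth e2).+1
  end.

Lemma depth_gt0 e : 0 < depth e.
Proof. by elim: e => [r|c|o e|o e1 _ e2|e] //= _; rewrite leq_max orbT. Qed.

(* The value of [e] ends up in register [d]; the registers above [d] serve as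
   an evaluation stack, and those below are left alone. *)
Fixpoint compile_expr (d : nat) (e : expr) : seq instr :=
  match e with
  | Reg r => [:: Un OpMov d r]
  | Cst c => [:: Const d c]
  | Op1 o e => rcons (compile_expr d e) (Un o d d)
  | Op2 o e1 e2 =>
      compile_expr d e1 ++ compile_expr d.+1 e2 ++ [:: Bin o d d d.+1]
  | Fetch e => rcons (compile_expr d e) (Get d d)
  end.

(* [d] is the number of registers in use; [Let] claims the next one. *)
Fixpoint compile (d : nat) (l : seq stmt) : seq instr :=
  match l with
  | [::] => [::]
  | Let e :: l => compile_expr d e ++ compile d.+1 l
  | Assign r e :: l => compile_expr d e ++ Un OpMov r d :: compile d l
  | Store a e :: l =>
      compile_expr d a ++ compile_expr d.+1 e ++ Put d d.+1 :: compile d l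
  | New e :: l =>
      compile_expr d e ++ Const d.+1 0 :: Alloc d.+2 d d.+1 :: compile d l
  end.

(** * Evaluation of expressions and forward rules for statements *)

Section Semantics.
Variable W : nat.

Definition upd (h : nat -> nat) (x v : nat) : nat -> nat :=
  fun y => if y == x then v else h y.

Definition zero_from (h : nat -> nat) (x len : nat) : nat -> nat :=
  fun y => if x <= y < x + len then 0 else h y.

(** Registers from [size env] up to [regs] are left unspecified, which makes them available as
    evaluation stack. *)
Definition holds (env : seq nat) (h : nat -> nat) (tp : nat) (s : state) :=
  [/\ top s = tp, regs <= tp, forall j, j < size env -> cells s j = nth 0 env j
    & forall x, regs <= x -> cells s x = h x].

Section Eval.
Variables (env : seq nat) (h : nat -> nat) (tp : nat).

Fixpoint eval (e : expr) : option nat :=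
  match e with
  | Reg r => if r < size env then Some (nth 0 env r %% 2 ^ W) else None
  | Cst c => Some (c %% 2 ^ W)
  | Op1 o e => obind (fun x => omap (modn^~ (2 ^ W)) (eval_un W o x)) (eval e)
  | Op2 o e1 e2 => obind (fun x => obind (fun y =>
      omap (modn^~ (2 ^ W)) (eval_bin W o x y)) (eval e2)) (eval e1)
  | Fetch e => obind (fun x =>
      if regs <= x < tp then Some (h x %% 2 ^ W) else None) (eval e)
  end.

Lemma eval_mod e v : eval e = Some v -> v %% 2 ^ W = v.
Proof.
case: e => [r|c|o e|o e1 e2|e] /=.
- by case: ifP => // _ [<-]; rewrite modn_mod.
- by case=> <-; rewrite modn_mod.
- by case: (eval e) => //= x; case: eval_un => //= y [<-]; rewrite modn_mod.
- case: (eval e1) => //= x; case: (eval e2) => //= y.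
  by case: eval_bin => //= z [<-]; rewrite modn_mod.
by case: (eval e) => //= x; case: ifP => // _ [<-]; rewrite modn_mod.
Qed.

(** The last clause carries the induction: the left operand, parked in [d], survives the evaluation
    of the right operand in [d.+1]. *)
Lemma compile_exprP e v d s :
  eval e = Some v -> size env <= d -> d + depth e <= regs ->
  holds env h tp s ->
  exists s', [/\ execs W (compile_expr d e) s = Some s', holds env h tp s',
    cells s' d = v & forall j, j < d -> cells s' j = cells s j].
Proof.
have wr r x s1 : r < regs -> size env <= r -> holds env h tp s1 ->
    exists s2, [/\ write W s1 r x = Some s2, holds env h tp s2,
      cells s2 r = x %% 2 ^ W & forall j, j < r -> cells s2 j = cells s1 j].
  move=> ltr ler [E1 E2 E3 E4]; rewrite /write E1 (leq_trans ltr E2).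
  eexists; split; [by [] | split=> //= | by rewrite /= eqxx |].
  - by move=> j ltj; rewrite ltn_eqF ?E3 //; apply: leq_trans ler.
  - by move=> x0 lex; rewrite gtn_eqF ?E4 //; apply: leq_trans lex.
  by move=> j ltj /=; rewrite ltn_eqF.
have rd r s1 : r < regs -> holds env h tp s1 -> read s1 r = Some (cells s1 r).
  by move=> ltr [E1 E2 _ _]; rewrite /read E1 (leq_trans ltr E2).
elim: e v d s => [r|c|o e IH|o e1 IH1 e2 IH2|e IH] v d s /=.
- case: ifP => // ltr [<-] led ltd hs.
  rewrite rd //=; last by lia.
  have [||s2 [-> h2 h3 h4]] := wr d (cells s r) s _ _ hs; [lia|lia|].
  by exists s2; split=> //; rewrite h3; case: hs => _ _ ->.
- move=> [<-] led ltd hs.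
  have [||s2 [-> h2 h3 h4]] := wr d c s _ _ hs; [lia|lia|].
  by exists s2.
- case Ee: (eval e) => [x|] //= Eo led ltd hs.
  have [s1 [E1 h1 h2 h3]] := IH _ d s Ee led ltd hs.
  rewrite -cats1 execs_cat E1 /= rd //=; last by have := depth_gt0 e; lia.
  rewrite h2; case: (eval_un W o x) Eo => //= y [<-].
  have ltd' : d < regs by have := depth_gt0 e; lia.
  have [s2 [-> k1 k2 k3]] := wr d y s1 ltd' led h1.
  by exists s2; split=> // j ltj; rewrite k3 ?h3.
- case Ee: (eval e1) => [x|] //=; case Ef: (eval e2) => [y|] //= Eo led ltd hs.
  have [|s1 [E1 h1 h2 h3]] := IH1 _ d s Ee led _ hs; first by lia.
  have [||s2 [E2 k1 k2 k3]] := IH2 _ d.+1 s1 Ef _ _ h1; [lia|lia|].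
  rewrite !execs_cat E1 /= execs_cat E2 /= !rd //=; [|have := depth_gt0 e2; lia..].
  rewrite k2 k3 // h2; case: (eval_bin W o x y) Eo => //= z [<-].
  have [|s3 [-> m1 m2 m3]] := wr d z s2 _ led k1; first by have := depth_gt0 e2; lia.
  by exists s3; split=> // j ltj; rewrite m3 // k3 ?h3 //; lia.
- case Ee: (eval e) => [x|] //=; case: ifP => // /andP[lex ltx] [<-] led ltd hs.
  have [s1 [E1 h1 h2 h3]] := IH _ d s Ee led ltd hs.
  have ltd' : d < regs by have := depth_gt0 e; lia.
  rewrite -cats1 execs_cat E1 /= rd //= h2.
  have [E _ _ Eh] := h1; rewrite /read E ltx /= Eh //.
  have [s2 [-> k1 k2 k3]] := wr d (h x) s1 ltd' led h1.
  by exists s2; split=> // j ltj; rewrite k3 ?h3.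
Qed.

End Eval.

Definition wp (l : seq stmt) env h tp (Q : state -> Prop) :=
  forall s, holds env h tp s ->
  exists2 s', execs W (compile (size env) l) s = Some s' & Q s'.

Lemma wp_nil env h tp (Q : state -> Prop) :
  (forall s, holds env h tp s -> Q s) -> wp [::] env h tp Q.
Proof. by move=> HQ s hs; exists s => //; apply: HQ. Qed.

Lemma wp_let v e l env h tp Q :
  eval env h tp e = Some v -> size env + depth e <= regs ->
  wp l (rcons env v) h tp Q -> wp (Let e :: l) env h tp Q.
Proof.
move=> Ee ltd Hl s hs /=.
have [s1 [E1 [h1 h2 h3 h4] h5 h6]] := compile_exprP Ee (leqnn _) ltd hs.
rewrite execs_cat E1 /=; move: Hl; rewrite /wp size_rcons; apply.
split=> // j; rewrite size_rcons ltnS nth_rcons leq_eqVlt.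
by case/orP => [/eqP ->|ltj]; rewrite ?ltnn ?eqxx // ltj h3.
Qed.

Lemma wp_assign v r e l env h tp Q :
  eval env h tp e = Some v -> size env + depth e <= regs -> r < size env ->
  wp l (set_nth 0 env r v) h tp Q -> wp (Assign r e :: l) env h tp Q.
Proof.
move=> Ee ltd ltr Hl s hs /=.
have [s1 [E1 [h1 h2 h3 h4] h5 h6]] := compile_exprP Ee (leqnn _) ltd hs.
have ltd' : size env < regs by have := depth_gt0 e; lia.
rewrite execs_cat E1 /= /read h1 (leq_trans ltd' h2) /= /write h1.
rewrite (ltn_trans ltr (leq_trans ltd' h2)) /= h5.
have sz : size (set_nth 0 env r v) = size env by rewrite size_set_nth; lia.
have ltv := eval_mod Ee.
move: Hl; rewrite /wp sz; apply; split=> //=.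
- move=> j; rewrite sz nth_set_nth /= => ltj.
  by case: eqP => // _; rewrite h3.
by move=> x lex; rewrite gtn_eqF ?h4 //; apply: leq_trans lex; lia.
Qed.

Lemma wp_store x v a e l env h tp Q :
  eval env h tp a = Some x -> eval env h tp e = Some v ->
  size env + maxn (depth a) (depth e).+1 <= regs -> regs <= x < tp ->
  wp l env (upd h x v) tp Q -> wp (Store a e :: l) env h tp Q.
Proof.
move=> Ea Ee ltd /andP[lex ltx] Hl s hs /=.
have [|s1 [E1 h1 h2 h3]] := compile_exprP Ea (leqnn _) _ hs; first by lia.
have [||s2 [E2 [k1 k2 k3 k4] k5 k6]] := @compile_exprP _ _ _ _ _ (size env).+1 s1 Ee _ _ h1.
- by lia.
- by lia.
rewrite execs_cat E1 /= execs_cat E2 /= /read k1.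
have ltr : (size env).+1 < regs by have := depth_gt0 e; lia.
rewrite (leq_trans _ k2) /=; last by lia.
rewrite (leq_trans _ k2) /=; last by lia.
rewrite k5 k6 // h2 /write k1 ltx /=.
have ltv := eval_mod Ee.
apply: Hl; split=> //= j.
  by move=> ltj; rewrite ltn_eqF ?k3 //; apply: leq_trans lex; lia.
by move=> lej; rewrite /upd ltv; case: eqP => // _; rewrite k4.
Qed.

(** The address returned by [Alloc] is dropped: cells are never released, so the new array starts at
    the old [tp]. The 3 counts the registers for length, initial value and that address. *)
Lemma wp_new len e l env h tp Q :
  eval env h tp e = Some len -> size env + maxn (depth e) 3 <= regs ->
  tp + len <= 2 ^ W ->
  wp l env (zero_from h tp len) (tp + len) Q -> wp (New e :: l) env h tp Q.
Proof.
move=> Ee ltd letp Hl s hs /=.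
have [|s1 [E1 [h1 h2 h3 h4] h5 h6]] := compile_exprP Ee (leqnn _) _ hs; first by lia.
rewrite execs_cat E1 /= /write /read h1.
have [lt0 lt1 lt2] : [/\ size env < tp, (size env).+1 < tp & (size env).+2 < tp].
  by split; apply: leq_trans h2; lia.
rewrite lt1 /= lt0 lt1 /= eqxx ltn_eqF // h5 mod0n lt2 /= /alloc /= letp /=.
apply: Hl; split=> //=; first by lia.
- move=> j ltj; rewrite leqNgt (ltn_trans ltj lt0) /= !ltn_eqF ?h3 //; lia.
- move=> x lex; rewrite /zero_from; case: ifP => // _.
  by rewrite !gtn_eqF ?h4 //; apply: leq_trans lex; lia.
Qed.

End Semantics.

(** * Digits and consecutive elements *)

Lemma sum_digits_split D m t (e : nat -> nat) : t <= m ->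
  exists x, \sum_(j < m) e j * D ^ j = \sum_(j < t) e j * D ^ j + x * D ^ t.
Proof.
move=> letm; exists (\sum_(t <= j < m) e j * D ^ (j - t)).
rewrite -!(big_mkord xpredT (fun j => e j * D ^ j)) (big_cat_nat (n := t)) //=.
congr (_ + _); rewrite big_distrl /=; apply: eq_big_nat => j /andP[letj _].
by rewrite -mulnA -expnD subnK.
Qed.

Lemma sum_digits_lt D m (e : nat -> nat) : (forall j, e j < D) ->
  \sum_(j < m) e j * D ^ j < D ^ m.
Proof.
move=> lte; elim: m => [|m IH]; first by rewrite big_ord0.
rewrite big_ord_recr /= expnS (leq_trans _ (leq_mul (lte m) (leqnn _))) //.
by rewrite mulSn ltn_add2r.
Qed.

Lemma sum_digits_mod D m t (e : nat -> nat) : (forall j, e j < D) -> t <= m ->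
  (\sum_(j < m) e j * D ^ j) %% D ^ t = \sum_(j < t) e j * D ^ j.
Proof.
move=> lte /(sum_digits_split D e)[x ->].
by rewrite addnC modnMDl modn_small // sum_digits_lt.
Qed.

Lemma sum_digits_nth D m i (e : nat -> nat) : (forall j, e j < D) -> i < m ->
  (\sum_(j < m) e j * D ^ j) %/ D ^ i %% D = e i.
Proof.
move=> lte /(sum_digits_split D e)[x ->].
have Dgt0 : 0 < D ^ i by rewrite expn_gt0 (leq_ltn_trans _ (lte 0)).
rewrite big_ord_recr /= expnS mulnA -addnA -mulnDl addnC divnMDl //.
by rewrite divn_small ?sum_digits_lt // addn0 addnC modnMDl modn_small.
Qed.

Lemma digit_le_sum D m i (e : nat -> nat) : i < m ->
  e i * D ^ i <= \sum_(j < m) e j * D ^ j.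
Proof. by move=> lti; rewrite (bigD1 (Ordinal lti)) //= leq_addr. Qed.

(** Subtracting before adding is the order in which the program replaces a digit; the truncated
    subtraction is exact by [digit_le_sum]. *)
Lemma sum_digits_upd D m i (e e' : nat -> nat) : i < m ->
  (forall j, j != i -> e' j = e j) ->
  \sum_(j < m) e' j * D ^ j =
  \sum_(j < m) e j * D ^ j - e i * D ^ i + e' i * D ^ i.
Proof.
move=> lti Ee; rewrite (bigD1 (Ordinal lti)) //= [in RHS](bigD1 (Ordinal lti)) //=.
rewrite addKn addnC; congr (_ + _); apply: eq_bigr => j neqj.
by rewrite Ee.
Qed.

Lemma trunc_log_sum_bits (u : pred nat) t l : l < t -> u l ->
  (forall i, l < i < t -> ~~ u i) -> trunc_log 2 (\sum_(j < t) u j * 2 ^ j) = l.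
Proof.
move=> ltl ul nu; have -> : \sum_(j < t) u j * 2 ^ j = \sum_(j < l.+1) u j * 2 ^ j.
  rewrite -!(big_mkord xpredT (fun j => u j * 2 ^ j)) (big_cat_nat (n := l.+1)) //=.
  rewrite [X in _ + X]big_nat_cond [X in _ + X]big1 ?addn0 // => i.
  by rewrite andbT => /nu /negPf ->.
have ltu j : u j < 2 by case: (u j).
apply: trunc_log_eq => //.
rewrite (sum_digits_lt l.+1 (e := fun j => nat_of_bool (u j))) // andbT.
by apply: leq_trans (digit_le_sum 2 (fun j => nat_of_bool (u j)) (ltnSn l)); rewrite ul mul1n.
Qed.

(** Reduction modulo [2 ^ t] keeps exactly the bits below [t], so the most significant one left is
    the predecessor of [t] in [u]. *)
Lemma msb_sum_bits (u : pred nat) m t l x : t <= m -> l < t -> u l ->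
  (forall i, l < i < t -> ~~ u i) -> x = \sum_(j < m) u j * 2 ^ j ->
  0 < x %% 2 ^ t /\ trunc_log 2 (x %% 2 ^ t) = l.
Proof.
move=> letm ltl ul nu ->.
rewrite (sum_digits_mod (e := fun j => nat_of_bool (u j))) //; last first.
  by move=> j; rewrite ltnS leq_b1.
split; last exact: trunc_log_sum_bits.
apply: leq_trans (digit_le_sum 2 (fun j => nat_of_bool (u j)) ltl).
by rewrite ul mul1n expn_gt0.
Qed.

(** * Consecutive elements of a set of naturals *)

Section Adjacent.
Implicit Types u v : pred nat.

Definition adj u j j' :=
  [/\ j < j', u j, u j' & forall i, j < i < j' -> ~~ u i].

Lemma adj_left u t : u 0 -> u t -> 0 < t -> exists l, adj u l t.
Proof.
move=> u0 ut t_gt0; pose P i := u i && (i < t).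
have exP : exists i, P i by exists 0; rewrite /P u0.
have leP i : P i -> i <= t by case/andP=> _ /ltnW.
case: (ex_maxnP exP leP) => l /andP[ul ltl] maxl; exists l; split=> // i.
by case/andP=> lti ltit; apply/negP => ui; have := maxl i; rewrite /P ui ltit; lia.
Qed.

Lemma adj_right u t m : u t -> u m -> t < m -> exists2 r, adj u t r & r <= m.
Proof.
move=> ut um ltm; pose P i := u i && (t < i).
have exP : exists i, P i by exists m; rewrite /P um.
case: (ex_minnP exP) => r /andP[ur ltr] minr.
exists r; last by apply: minr; rewrite /P um.
split=> // i /andP[lti ltir]; apply/negP => ui.
by have := minr i; rewrite /P ui lti; lia.
Qed.

Lemma adj_eq u v m : (forall i, i <= m -> u i = v i) ->
  forall j j', j' <= m -> adj u j j' -> adj v j j'.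
Proof.
move=> Euv j j' lej [ltj uj uj' nu]; split=> //.
- by rewrite -Euv //; lia.
- by rewrite -Euv.
by move=> i lti; rewrite -Euv ?nu //; lia.
Qed.

(** This justifies overwriting: old pairs that survive the removal of [t] neither start at [l] nor
    end at [r]. *)
Lemma adj_remove u v l t r j j' : adj u l t -> adj u t r ->
  (forall i, v i = u i && (i != t)) -> adj v j j' ->
  (j = l /\ j' = r) \/ [/\ adj u j j', j != l & j' != r].
Proof.
move=> [ltl ul _ nl] [ltr _ ur nr] Ev [ltj vj vj' nv].
have [uj nejt] : u j /\ j != t by move: vj; rewrite Ev => /andP[].
have [uj' nejt'] : u j' /\ j' != t by move: vj'; rewrite Ev => /andP[].
have nl' i : l < i < t -> i != j /\ i != j'.
  by move=> /nl nui; split; apply: contra nui => /eqP ->.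
have nr' i : t < i < r -> i != j /\ i != j'.
  by move=> /nr nui; split; apply: contra nui => /eqP ->.
have vl : ~~ (j < l < j') by apply/negP => /nv; rewrite Ev ul; lia.
have vr : ~~ (j < r < j') by apply/negP => /nv; rewrite Ev ur; lia.
have := (nl' j, nl' j', nr' j, nr' j'); case=> [[[c1 c2] c3] c4].
(* Neither [l] nor [r] lies strictly between [j] and [j'], and neither [j] nor [j'] lies strictly
   between [l] and [t] or [t] and [r]; a pair that straddles [t] must therefore be (l, r). *)
case: (boolP (j < t < j')) => jtj'.
  by left; split; apply/eqP; lia.
right; split=> //; last 2 first; try by apply/negP => /eqP ?; subst; lia.
split=> // i lti; have /nv : j < i < j' by [].
by rewrite Ev negb_and negbK => /orP[//|/eqP Ei]; subst; lia.
Qed.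

End Adjacent.

(** * The transition monoid and the invariants of the data structure *)

(** A state describes a prefix only; the map that a factor induces on the states describes it in
    every context, so neighbouring factors can be combined in any order of arrival. *)
Lemma regular_morphism (Sigma : finType) (L : seq Sigma -> Prop) : regular L ->
  exists m (phi : seq Sigma -> nat) (mul : nat -> nat -> nat) (acc : pred nat),
  [/\ phi [::] = 0, {morph phi : u v / u ++ v >-> mul u v},
      forall u, phi u < m, forall x y, mul x y < m & forall u, L u <-> acc (phi u)].
Proof.
case=> A HA; pose M : finType := {ffun dfa_state A -> dfa_state A}.
pose one : M := [ffun q => q].
(* The identity is coded by 0 because fresh memory is filled with zeros. *)
pose enc (f : M) := if f == one then 0 else (enum_rank f).+1.
pose dec x : M := if x is x'.+1 then nth one (enum M) x' else one.
have encK : cancel enc dec.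
  by move=> f; rewrite /enc; case: eqP => [->|_] //=; rewrite nth_enum_rank.
pose act u : M := [ffun q => foldl (@dfa_trans _ A) q u].
have enc_lt f : enc f < #|M|.+1 by rewrite /enc; case: ifP; rewrite ?ltnS ?ltn_ord.
exists #|M|.+1, (enc \o act), (fun x y => enc [ffun q => dec y (dec x q)]),
  (fun x => dec x (dfa_start A) \in dfa_final A); split=> //= [|u v|u].
- by have -> : act [::] = one; [apply/ffunP=> q; rewrite !ffunE | rewrite /enc eqxx].
- by rewrite !encK; congr enc; apply/ffunP=> q; rewrite !ffunE foldl_cat.
by rewrite HA /dfa_accepts encK ffunE.
Qed.

(** * Values of the factors of the input word *)

Section Factors.
Variables (Sigma : finType) (phi : seq Sigma -> nat) (mul : nat -> nat -> nat).
Hypothesis phi0 : phi [::] = 0.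
Hypothesis phiM : {morph phi : u v / u ++ v >-> mul u v}.
Variables (n : nat) (w : n.-tuple Sigma).

Definition factor i j := phi (take (j - i) (drop i w)).

Lemma factor_id i : factor i i = 0.
Proof. by rewrite /factor subnn take0. Qed.

Lemma factor_cat i j k : i <= j <= k -> factor i k = mul (factor i j) (factor j k).
Proof.
case/andP=> leij lejk; rewrite /factor -phiM; congr phi.
have -> : k - i = (j - i) + (k - j) by rewrite addnC addnBA // subnK.
by rewrite takeD drop_drop subnK.
Qed.

(** The last block may be short; a block boundary beyond [n] then stands for the end of the word. *)
Lemma factor_clip i j k : n <= j -> n <= k -> factor i j = factor i k.
Proof.
by move=> lej lek; rewrite /factor !take_oversize // size_drop size_tuple leq_sub2r.
Qed.

Lemma factor_letter (i : 'I_n) : factor i i.+1 = phi [:: tnth w i].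
Proof.
rewrite /factor (drop_nth (tnth w i)) ?size_tuple // subSnn /= take0.
by rewrite -tnth_nth.
Qed.

Lemma factor_all j : n <= j -> factor 0 j = phi w.
Proof. by move=> lej; rewrite /factor drop0 take_oversize // size_tuple subn0. Qed.

End Factors.

(** * Effect of one new position on the gaps inside and between blocks *)

Section Gaps.
Variables (n B : nat).
Hypotheses (n_gt0 : 0 < n) (B_gt0 : 0 < B).
Implicit Types K : pred nat.

(** [nblocks] is the ceiling of n / B; [n1] exceeds it, so that the boundary behind the last block
    has a cell as well. *)
Let n1 := n %/ B + 2.
Let nblocks := n.-1 %/ B + 1.

(* The known positions of block [k] are the unset indices in [1, B]; the
   indices 0 and [B + 1] are sentinels. *)
Definition gap K k j := [|| j == 0, B < j | ~~ K (k * B + j.-1)].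

(** Positions from [n] on never arrive and stay gaps in the mask of the last block; counting them as
    known here lets a short last block become full. *)
Definition full K k := all (fun q => (n <= q) || K q) (iota (k * B) B).

(** The same shape one level up: index [j] stands for block [j.-1], between the sentinels 0 and
    [nblocks.+1]. *)
Definition block_gap K j := [|| j == 0, nblocks < j | ~~ full K j.-1].

Lemma nblocks_lt : nblocks < n1.
Proof. by rewrite /nblocks /n1 addn2 addn1 !ltnS leq_div2r // leq_pred. Qed.

Section AddPosition.
Variables (K : pred nat) (p : nat).
Hypotheses (p_lt : p < n) (Kp : ~~ K p).
Let K' : pred nat := fun q => (q == p) || K q.
Let k := p %/ B.
Let t := (p %% B).+1.

Let Ep : p = k * B + t.-1. Proof. exact: divn_eq. Qed.
Let t_le : t <= B. Proof. by rewrite ltn_mod. Qed.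

Lemma block_lt : k < n1.
Proof. by rewrite /n1 addn2 ltnS ltnW // ltnS leq_div2r // ltnW. Qed.

Lemma block_lt_nblocks : k < nblocks.
Proof. by rewrite /nblocks addn1 ltnS leq_div2r //; lia. Qed.

Lemma gap_position : gap K k t.
Proof. by rewrite /gap -Ep Kp !orbT. Qed.

Lemma gap_step i : gap K' k i = gap K k i && (i != t).
Proof.
rewrite /gap /K'; case: i => [|i] //=; rewrite [in LHS]Ep eqn_add2l /= eqSS.
by case: ltnP => /= lti; case: eqP => //= Ei; lia.
Qed.

Lemma div_block k0 i : 0 < i <= B -> (k0 * B + i.-1) %/ B = k0.
Proof. by move=> lei; rewrite divnMDl // divn_small ?addn0 //; lia. Qed.

Lemma gap_other (k0 : nat) : k0 != k -> gap K' k0 =1 gap K k0.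
Proof.
move=> nek i; rewrite /gap /K'; case: i => [|i] //=; case: ltnP => //= lei.
case: eqP => // Ei; case/eqP: nek; rewrite /k -Ei.
by rewrite -[i]/(i.+1.-1) div_block.
Qed.

Lemma not_full : ~~ full K k.
Proof.
rewrite -has_predC; apply/hasP; exists p; last by rewrite /= negb_or Kp -ltnNge p_lt.
by rewrite mem_iota; move: Ep t_le; lia.
Qed.

Lemma full_other (k0 : nat) : k0 != k -> full K' k0 = full K k0.
Proof.
move=> nek; apply: eq_in_all => q; rewrite mem_iota /K' => leq.
case: eqP => // Eq; case/eqP: nek; rewrite /k -Eq.
have -> : q = k0 * B + (q - k0 * B).+1.-1 by lia.
by rewrite div_block //; lia.
Qed.

(** The block gets full when no gap is left of [t] but the sentinel, and the next one on the right
    is a sentinel or, standing for position [k * B + r.-1], lies behind the word. Comparing [l] with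
    a boolean expresses that [l] is 0 and the boolean true, as the program computes it. *)
Lemma full_step l r : adj (gap K k) l t -> adj (gap K k) t r -> r <= B.+1 ->
  full K' k = (l < (n < k * B + r) || (B < r)).
Proof.
move=> [ltl ul _ nl] [ltr _ ur nr] ler; apply/idP/idP => [/allP F|].
  have {}F i : i < B -> k * B + i < n -> K' (k * B + i).
    move=> lti ltn; have := F (k * B + i); rewrite mem_iota leq_addr ltn_add2l lti.
    by move/(_ isT); rewrite leqNgt ltn.
  have -> : l = 0.
    move: ul; case: (l) ltl => // l0 lt0; rewrite /gap ltnNge /=.
    have := F l0; rewrite /K' Ep eqn_add2l; case: eqP => [|_]; first by lia.
    by move=> /= -> //; lia.
  rewrite lt0b; case: ltnP => //= len; case: ltnP => //= leB.
  move: ur; rewrite /gap (gtn_eqF (leq_ltn_trans _ ltr)) //= ltnNge leB /=.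
  have := F r.-1; rewrite /K' Ep eqn_add2l; case: eqP => [|_]; first by lia.
  by move=> /= -> //; lia.
move=> lf; have l0 : l = 0 by move: lf; case: (_ || _); lia.
apply/allP => q; rewrite mem_iota => leq; rewrite /K'; case: ltnP => //= ltq.
have Eq : q = k * B + (q - k * B).+1.-1 by lia.
case: (ltngtP q p) => //= neq.
  have /nl : l < (q - k * B).+1 < t by move: Ep; lia.
  by rewrite /gap -Eq /= negb_or negbK => /andP[].
have /nr : t < (q - k * B).+1 < r.
  by move: lf Ep; rewrite l0 lt0b => /orP[]; lia.
by rewrite /gap -Eq /= negb_or negbK => /andP[].
Qed.

Lemma block_gap_step i : full K' k -> block_gap K' i = block_gap K i && (i != k.+1).
Proof.
move=> F; rewrite /block_gap; case: i => // i; rewrite eqSS /=.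
case: (eqVneq i k) => [->|nek]; last by rewrite full_other // andbT.
by rewrite F /= orbF andbF; have := block_lt_nblocks; lia.
Qed.

Lemma block_gap_same : ~~ full K' k -> block_gap K' =1 block_gap K.
Proof.
move=> nf [|i] //; rewrite /block_gap /=.
case: (eqVneq i k) => [->|nek]; last by rewrite full_other.
by rewrite nf not_full.
Qed.

End AddPosition.
End Gaps.

(** * The invariants and their preservation *)

Section Invariants.
Variables (Sigma : finType) (phi : seq Sigma -> nat) (mul : nat -> nat -> nat).
Hypothesis phi0 : phi [::] = 0.
Hypothesis phiM : {morph phi : u v / u ++ v >-> mul u v}.
Variable (D : nat).
Hypothesis phi_lt : forall u, phi u < D.
Variables (base n B : nat) (w : n.-tuple Sigma).
Hypotheses (n_gt0 : 0 < n) (B_gt0 : 0 < B).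
Implicit Types (K : pred nat) (h : nat -> nat).

Let n1 := n %/ B + 2.
Let addr i k := base + i * n1 + k.
Let f := factor phi w.
Let nblocks := n.-1 %/ B + 1.

(* Of the six arrays, cell [k] of the first three holds the mask of known
   positions of block [k], the same mask reversed, and the digit [e j] for every
   offset [j]; only the digits at gaps are meaningful. *)
Definition block_inv h K k := exists e : nat -> nat,
  [/\ h (addr 0 k) + \sum_(j < B.+2) gap B K k j * 2 ^ j = (2 ^ B.+2).-1,
      h (addr 1 k) + \sum_(j < B.+2) gap B K k (B.+1 - j) * 2 ^ j = (2 ^ B.+2).-1,
      forall j, e j < D,
      h (addr 2 k) = \sum_(j < B.+1) e j * D ^ j
    & forall j j', adj (gap B K k) j j' -> j' <= B.+1 ->
        e j = f (k * B + j) (k * B + j'.-1)].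

(* Cell [x] of the last three arrays describes the boundary in front of block
   [x]: the length of the run of full blocks ending there, the length and the
   value of the run starting there. *)
Definition runs_inv h K := forall j j', adj (block_gap n B K) j j' -> j' <= nblocks.+1 ->
  [/\ h (addr 3 j'.-1) = j'.-1 - j, h (addr 4 j) = j'.-1 - j
    & h (addr 5 j) = f (j * B) (j'.-1 * B)].

Definition heap_inv h K := (forall k, k < n1 -> block_inv h K k) /\ runs_inv h K.

Lemma addr_eq i i' k k' : k < n1 -> k' < n1 ->
  (addr i k == addr i' k') = (i == i') && (k == k').
Proof.
move=> ltk ltk'; rewrite /addr -!addnA eqn_add2l.
apply/eqP/andP => [E|[/eqP -> /eqP ->] //].
have n1_gt0 : 0 < n1 by rewrite /n1 addn2.
have := congr1 (divn^~ n1) E; rewrite !divnMDl // !divn_small // !addn0 => Ei.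
by move: E; rewrite Ei => /addnI ->; rewrite !eqxx.
Qed.

Lemma sum_pow2 m : (\sum_(j < m) 1 * 2 ^ j).+1 = 2 ^ m.
Proof.
elim: m => [|m IH]; first by rewrite big_ord0.
by rewrite big_ord_recr /= -addSn IH expnS; lia.
Qed.

Lemma adj_all (u : pred nat) j j' : (forall i, u i) -> adj u j j' -> j' = j.+1.
Proof.
move=> uT [ltj _ _ nu]; apply/eqP; rewrite eqn_leq ltj andbT leqNgt.
by apply/negP => lt; have := nu j.+1; rewrite uT lt ltnSn => /(_ isT).
Qed.

(** Registers and constant tables lie below [base] and may change freely. *)
Lemma heap_inv_ext h h' K : (forall x, base <= x -> h' x = h x) ->
  heap_inv h K -> heap_inv h' K.
Proof.
move=> Eh [Hb Hr]; have E i x : h' (addr i x) = h (addr i x).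
  by rewrite Eh // /addr -addnA leq_addr.
split=> [k0 ltk0|j j' aj lej]; last by rewrite !E; apply: Hr.
by have [e He] := Hb k0 ltk0; exists e; rewrite !E.
Qed.

(** With nothing known every index is a gap, so all runs are empty: empty masks, lengths 0, and
    identities, which are coded by 0. *)
Lemma heap_inv0 h : (forall x, base <= x -> h x = 0) -> heap_inv h pred0.
Proof.
move=> h0; have ha i k : h (addr i k) = 0 by rewrite h0 // /addr -addnA leq_addr.
split=> [k ltk|j j' adjj lej].
  have gapT j : gap B pred0 k j by rewrite /gap !orbT.
  exists (fun=> 0); rewrite !ha; split.
  - by under eq_bigr do rewrite gapT; rewrite -sum_pow2.
  - by under eq_bigr do rewrite gapT; rewrite -sum_pow2.
  - by move=> _; apply: leq_ltn_trans (phi_lt [::]).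
  - by rewrite big1.
  by move=> j j' /(adj_all gapT) ->; rewrite /f factor_id.
have gT i : block_gap n B pred0 i.
  rewrite /block_gap; case: i => // i; case: ltnP => //= lei.
  rewrite -has_predC; apply/hasP; exists (i * B).
    by rewrite mem_iota leqnn /= -[X in X < _]addn0 ltn_add2l.
  rewrite /= orbF -ltnNge; apply: (@leq_ltn_trans n.-1); last by case: (n) n_gt0.
  by apply: leq_trans (leq_divM n.-1 B); rewrite leq_mul2r; lia.
have ltj' := nblocks_lt n B; move: adjj => /(adj_all gT) Ej; subst j' => /=.
by rewrite !ha subnn /f factor_id.
Qed.

Section Step.
Variables (K : pred nat) (p : nat).
Hypotheses (p_lt : p < n) (Kp : ~~ K p).
Let K' : pred nat := fun q => (q == p) || K q.
Let k := p %/ B.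
Let t := (p %% B).+1.

Let Ep : p = k * B + t.-1. Proof. exact: divn_eq. Qed.
Let t_le : t <= B. Proof. by rewrite ltn_mod. Qed.
Let gap_stepE i : gap B K' k i = gap B K k i && (i != t).
Proof. exact: (gap_step n_gt0 B_gt0 p_lt Kp). Qed.

Lemma block_inv_eq h h' (k0 : nat) : k0 != k ->
  (forall i, i < 3 -> h' (addr i k0) = h (addr i k0)) ->
  block_inv h K k0 -> block_inv h' K' k0.
Proof.
move=> nek Eh [e [e0 e1 lte e2 e3]]; have E := gap_other n_gt0 B_gt0 p_lt Kp nek.
exists e; rewrite !Eh //; split=> //.
- by under eq_bigr do rewrite E.
- by under eq_bigr do rewrite E.
by move=> j j' adjj lej; apply: e3 => //; apply: (adj_eq (m := j')) adjj => // i _; rewrite E.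
Qed.

(** The run on the right is keyed by the gap in front of it, which is [t] itself; hence the digit
    [e t]. *)
Lemma merge_value e l r : adj (gap B K k) l t -> adj (gap B K k) t r -> r <= B.+1 ->
  (forall j j', adj (gap B K k) j j' -> j' <= B.+1 ->
     e j = f (k * B + j) (k * B + j'.-1)) ->
  mul (mul (e l) (f p p.+1)) (e t) = f (k * B + l) (k * B + r.-1).
Proof.
move=> al ar ler He; rewrite (He _ _ al) ?(He _ _ ar) //; last by lia.
case: al ar => ltl _ _ _ [ltr _ _ _]; rewrite -Ep.
have -> : k * B + t = p.+1 by rewrite Ep addnS.
by rewrite -!factor_cat //; apply/andP; split; lia.
Qed.

(** The bit of [t] is not yet set, so adding a power of two sets it without a carry. Only digit [l]
    changes; digit [t] goes stale. *)
Lemma block_step h h' l r (e : nat -> nat) v :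
  adj (gap B K k) l t -> adj (gap B K k) t r -> r <= B.+1 ->
  h (addr 0 k) + \sum_(j < B.+2) gap B K k j * 2 ^ j = (2 ^ B.+2).-1 ->
  h (addr 1 k) + \sum_(j < B.+2) gap B K k (B.+1 - j) * 2 ^ j = (2 ^ B.+2).-1 ->
  (forall j, e j < D) ->
  h (addr 2 k) = \sum_(j < B.+1) e j * D ^ j ->
  (forall j j', adj (gap B K k) j j' -> j' <= B.+1 ->
     e j = f (k * B + j) (k * B + j'.-1)) ->
  h' (addr 0 k) = h (addr 0 k) + 2 ^ t ->
  h' (addr 1 k) = h (addr 1 k) + 2 ^ (B.+1 - t) ->
  v = f (k * B + l) (k * B + r.-1) ->
  h' (addr 2 k) = h (addr 2 k) - e l * D ^ l + v * D ^ l ->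
  block_inv h' K' k.
Proof.
move=> al ar ler.
have ltl : l < B.+1 by case: al => ltl _ _ _; apply: leq_trans ltl _; apply: leqW.
have ltt : t < B.+2 by rewrite ltnS leqW.
have ltt' : B.+1 - t < B.+2 by rewrite ltnS leq_subr.
move=> e0 e1 lte e2 e3 H0 H1 Ev H2.
exists (fun j => if j == l then v else e j); split; rewrite ?H0 ?H1 ?H2.
- pose u j := gap B K k j : nat.
  have ut : u t = 1 by rewrite /u gap_position.
  have := digit_le_sum 2 u ltt; rewrite ut mul1n => le2.
  rewrite (@sum_digits_upd 2 B.+2 t u (gap B K' k)) // => [|j nej].
    by rewrite gap_stepE eqxx andbF addn0 ut mul1n -addnA subnKC.
  by rewrite gap_stepE nej andbT.
- pose u j := gap B K k (B.+1 - j) : nat.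
  have ut : u (B.+1 - t) = 1 by rewrite /u subKn ?(gap_position B Kp) // leqW.
  have := digit_le_sum 2 u ltt'; rewrite ut mul1n => le2.
  rewrite (@sum_digits_upd 2 B.+2 (B.+1 - t) u (fun j => gap B K' k (B.+1 - j))) //.
    by rewrite gap_stepE subKn ?leqW // eqxx andbF addn0 ut mul1n -addnA subnKC.
  move=> j nej; rewrite gap_stepE; case: eqP => [Ej|]; rewrite ?andbT //.
  case: (leqP j B.+1) => lej; first by rewrite -Ej subKn ?eqxx in nej.
  (* Past [B.+1] the truncated subtraction gives 0, which is not [t]. *)
  by move: Ej; rewrite (eqP (ltnW lej)).
- by move=> j; case: eqP => // _; rewrite Ev; apply: phi_lt.
- rewrite (@sum_digits_upd D B.+1 l e (fun j => if j == l then v else e j)) ?eqxx -?e2 //.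
  by move=> j /negPf ->.
move=> j j' aj lej; have [[-> ->]|[aj' nel ner]] := adj_remove al ar gap_stepE aj.
  by rewrite eqxx.
by rewrite (negPf nel); apply: e3.
Qed.

Lemma runs_inv_eq h h' : ~~ full n B K' k ->
  (forall i x, 2 < i -> h' (addr i x) = h (addr i x)) ->
  runs_inv h K -> runs_inv h' K'.
Proof.
move=> nf Eh H j j' aj lej; rewrite !Eh //; apply: H => //.
by apply: (adj_eq (m := j')) aj => // i _; rewrite (block_gap_same n_gt0 B_gt0 p_lt Kp nf).
Qed.

(** A new full block touches the right end of the run on its left and the left end of the run on its
    right; this is why lengths are kept at both ends. *)
Lemma runs_step h h' l r : full n B K' k -> adj (block_gap n B K) l k.+1 ->
  adj (block_gap n B K) k.+1 r -> r <= nblocks.+1 ->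
  (forall x, x < n1 -> [/\ h' (addr 3 x) = (if x == r.-1 then r.-1 - l else h (addr 3 x)),
    h' (addr 4 x) = (if x == l then r.-1 - l else h (addr 4 x))
   & h' (addr 5 x) = (if x == l then f (l * B) (r.-1 * B) else h (addr 5 x))]) ->
  runs_inv h K -> runs_inv h' K'.
Proof.
move=> F al ar ler Eh H j j' aj lej.
have ltj : j < j' by case: aj.
have ltn1 := nblocks_lt n B.
have [|h1 h2 h3] := Eh j; first by lia.
have [|h1' h2' h3'] := Eh j'.-1; first by lia.
rewrite h1' h2 h3.
have Eg i := block_gap_step n_gt0 B_gt0 p_lt Kp i F.
have [[-> ->]|[aj' nel ner]] := adj_remove al ar Eg aj.
  by rewrite !eqxx.
rewrite (negPf nel); have -> : (j'.-1 == r.-1) = false; last exact: H.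
by apply/negbTE/eqP; move/eqP: ner; case: al ar => ? _ _ _ [? _ _ _]; lia.
Qed.

End Step.

(** Only the sentinels remain, so the run at boundary 0 comprises all blocks; it reaches at least to
    [n], where factors are clipped. *)
Lemma heap_inv_full h K : heap_inv h K -> (forall q, q < n -> K q) ->
  h (addr 5 0) = phi w.
Proof.
move=> [_ H] KT; have [||_ _ ->] := H 0 nblocks.+1 => //.
  split=> // [|i lti]; first by rewrite /block_gap ltnSn orbT.
  rewrite /block_gap !negb_or negbK -leqNgt; apply/and3P; split; try by lia.
  by apply/allP => q _; case: ltnP => //= /KT.
rewrite mul0n /f factor_all //= /nblocks mulnDl mul1n.
by have := divn_eq n.-1 B; have := ltn_pmod n.-1 B_gt0; lia.
Qed.

End Invariants.

(** * The program *)

Section Evaluation.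
Variables (W : nat) (env : seq nat) (h : nat -> nat) (tp : nat).
Notation ev e v := (eval W env h tp e = Some (v : nat)).

Lemma eval_reg r v : r < size env -> nth 0 env r = v -> v < 2 ^ W -> ev (Reg r) v.
Proof. by move=> /= -> -> ltv; rewrite modn_small. Qed.

Lemma eval_cst v : v < 2 ^ W -> ev (Cst v) v.
Proof. by move=> ltv; rewrite /= modn_small. Qed.

Lemma eval_bound e v : ev e v -> v < 2 ^ W.
Proof. by move/eval_mod => <-; rewrite ltn_mod expn_gt0. Qed.

Lemma eval_inc e x : ev e x -> x.+1 < 2 ^ W -> ev (Op1 OpInc e) x.+1.
Proof. by move=> /= -> /= ltx; rewrite modn_small. Qed.

Lemma eval_msb e x : ev e x -> 0 < x -> ev (Op1 OpMsb e) (trunc_log 2 x).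
Proof.
move=> E x_gt0; rewrite /= E /= ifN -?lt0n //= modn_small //.
apply: leq_ltn_trans (eval_bound E); apply: leq_trans (trunc_logP (ltnSn 1) x_gt0).
by rewrite ltnW // ltn_expl.
Qed.

Lemma eval_add e1 e2 x y : ev e1 x -> ev e2 y -> x + y < 2 ^ W ->
  ev (Op2 OpAdd e1 e2) (x + y).
Proof. by move=> /= -> -> /= lt; rewrite modn_small. Qed.

Lemma eval_sub e1 e2 x y : ev e1 x -> ev e2 y -> y <= x ->
  ev (Op2 OpSub e1 e2) (x - y).
Proof.
move=> E1 E2 leyx; rewrite /= E1 E2 /= addnC -addnBA // modnDl modn_small //.
exact: leq_ltn_trans (leq_subr _ _) (eval_bound E1).
Qed.

Lemma eval_div e1 e2 x y : ev e1 x -> ev e2 y -> 0 < y ->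
  ev (Op2 OpDiv e1 e2) (x %/ y).
Proof.
move=> E1 E2 y_gt0; rewrite /= E1 E2 /= ifN -?lt0n //= modn_small //.
exact: leq_ltn_trans (leq_div _ _) (eval_bound E1).
Qed.

Lemma eval_modn e1 e2 x y : ev e1 x -> ev e2 y -> 0 < y ->
  ev (Op2 OpMod e1 e2) (x %% y).
Proof.
move=> E1 E2 y_gt0; rewrite /= E1 E2 /= ifN -?lt0n //= modn_small //.
exact: leq_ltn_trans (leq_mod _ _) (eval_bound E1).
Qed.

Lemma eval_shl e1 e2 x y : ev e1 x -> ev e2 y -> x * 2 ^ y < 2 ^ W ->
  ev (Op2 OpShl e1 e2) (x * 2 ^ y).
Proof. by move=> /= -> -> /= lt; rewrite modn_small. Qed.

Lemma eval_shr e1 e2 x y : ev e1 x -> ev e2 y ->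
  ev (Op2 OpShr e1 e2) (x %/ 2 ^ y).
Proof.
move=> E1 E2; rewrite /= E1 E2 /= modn_small //.
exact: leq_ltn_trans (leq_div _ _) (eval_bound E1).
Qed.

Lemma eval_lt e1 e2 x y : ev e1 x -> ev e2 y -> 1 < 2 ^ W ->
  ev (Op2 OpLt e1 e2) (x < y).
Proof.
by move=> /= -> -> lt; rewrite /= modn_small // (leq_ltn_trans (leq_b1 _)).
Qed.

Lemma eval_or e1 e2 (x y : bool) : ev e1 x -> ev e2 y -> 1 < 2 ^ W ->
  ev (Op2 OpOr e1 e2) (x || y).
Proof.
move=> /= -> -> lt /=; have -> : Nat.lor x y = (x || y) by case: x; case: y.
by rewrite modn_small // (leq_ltn_trans (leq_b1 _)).
Qed.

Lemma eval_fetch e x v : ev e x -> regs <= x < tp -> h x = v -> v < 2 ^ W ->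
  ev (Fetch e) v.
Proof. by move=> /= -> /= -> -> ltv; rewrite modn_small. Qed.

End Evaluation.

Lemma wp_let_eq W v v' e l env h tp Q :
  eval W env h tp e = Some v -> v = v' -> size env + depth e <= regs ->
  wp W l (rcons env v') h tp Q -> wp W (Let e :: l) env h tp Q.
Proof. by move=> + <-; apply: wp_let. Qed.

Lemma wp_store_eq W x x' v v' a e l env h tp Q :
  eval W env h tp a = Some x -> x = x' -> eval W env h tp e = Some v -> v = v' ->
  size env + maxn (depth a) (depth e).+1 <= regs -> regs <= x' < tp ->
  wp W l env (upd h x' v') tp Q -> wp W (Store a e :: l) env h tp Q.
Proof. by move=> + <- + <-; apply: wp_store. Qed.

(** * The code, its constant tables and its size bounds *)

Section Program.
Variables (Sigma : finType) (phi : seq Sigma -> nat) (mul : nat -> nat -> nat).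
Variables (acc : pred nat) (beta : nat).
Let b := 2 ^ beta.
Let D := 2 ^ b.

(* The model has no multiplication: digits and table rows are addressed by
   shifts, hence the base D = 2 ^ b with b itself a power of two. *)
Definition table : seq nat :=
  [seq mul (i %/ D) (i %% D) | i <- iota 0 (D * D)] ++
  [seq phi [:: a] | a <- enum Sigma] ++ [seq acc x : nat | x <- iota 0 D].

Definition base := regs + size table.

Lemma size_table : size table = D * D + #|Sigma| + D.
Proof. by rewrite !size_cat 3!size_map !size_iota -cardT addnA. Qed.

Lemma nth_table_mul x y : x < D -> y < D -> nth 0 table (x * D + y) = mul x y.
Proof.
move=> ltx lty; have ltxy : x * D + y < D * D by nia.
rewrite nth_cat size_map size_iota ltxy (nth_map 0) ?size_iota // nth_iota //.
by rewrite add0n divnMDl ?divn_small ?addn0 ?modnMDl ?modn_small //; lia.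
Qed.

Lemma nth_table_letter a : nth 0 table (D * D + enum_rank a) = phi [:: a].
Proof.
rewrite nth_cat size_map size_iota ltnNge leq_addr /= addKn nth_cat size_map.
by rewrite -cardT ltn_ord (nth_map a) ?nth_enum_rank // -cardT.
Qed.

Lemma nth_table_acc x : x < D -> nth 0 table (D * D + #|Sigma| + x) = acc x.
Proof.
move=> ltx; rewrite nth_cat size_map size_iota ltnNge -addnA leq_addr /= addKn.
rewrite nth_cat size_map -cardT ltnNge leq_addr /= addKn.
by rewrite (nth_map 0) ?size_iota // nth_iota.
Qed.

Local Notation "e1 ⊕ e2" := (Op2 OpAdd e1 e2) (at level 50, left associativity).
Local Notation "e1 ⊖ e2" := (Op2 OpSub e1 e2) (at level 50, left associativity).
Local Notation "e1 ≪ e2" := (Op2 OpShl e1 e2) (at level 45, left associativity).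
Local Notation "e1 ≫ e2" := (Op2 OpShr e1 e2) (at level 45, left associativity).
Local Notation "e1 ⊘ e2" := (Op2 OpDiv e1 e2) (at level 40).
Local Notation "e1 ⊙ e2" := (Op2 OpMod e1 e2) (at level 40).
Local Notation msb e := (Op1 OpMsb e).
Local Notation inc e := (Op1 OpInc e).

Definition mul_expr e1 e2 := Fetch (Cst regs ⊕ ((e1 ≪ Cst b) ⊕ e2)).
Definition letter_expr e := Fetch (Cst (regs + D * D) ⊕ e).
Definition acc_expr e := Fetch (Cst (regs + (D * D + #|Sigma|)) ⊕ e).
Definition digit_expr e j := (e ≫ (j ≪ Cst beta)) ⊙ Cst D.

Local Notation Rletter := (Reg 0) (only parsing).
Local Notation Rpos := (Reg 1) (only parsing).
Local Notation Rlen := (Reg 2) (only parsing).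
Local Notation Roldtot := (Reg 3) (only parsing).
Local Notation Rbsz := (Reg 4) (only parsing).
Local Notation Rp := (Reg 5) (only parsing).
Local Notation Ro := (Reg 6) (only parsing).
Local Notation Rk := (Reg 7) (only parsing).
Local Notation Rn1 := (Reg 8) (only parsing).
Local Notation Rtot := (Reg 9) (only parsing).
Local Notation Radr0 := (Reg 10) (only parsing).
Local Notation Radr1 := (Reg 11) (only parsing).
Local Notation Radr2 := (Reg 12) (only parsing).
Local Notation Radr3 := (Reg 13) (only parsing).
Local Notation Radr4 := (Reg 14) (only parsing).
Local Notation Radr5 := (Reg 15) (only parsing).
Local Notation Rones := (Reg 16) (only parsing).
Local Notation Rt := (Reg 17) (only parsing).
Local Notation Rbit := (Reg 18) (only parsing).
Local Notation Rrbit := (Reg 19) (only parsing).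
Local Notation Rl := (Reg 20) (only parsing).
Local Notation Rr := (Reg 21) (only parsing).
Local Notation Rel := (Reg 22) (only parsing).
Local Notation Ret := (Reg 23) (only parsing).
Local Notation Rprod1 := (Reg 24) (only parsing).
Local Notation Rprod := (Reg 25) (only parsing).
Local Notation Risfull := 26 (only parsing).
Local Notation Rlrun := (Reg 27) (only parsing).
Local Notation Rrrun := (Reg 28) (only parsing).
Local Notation Rrun := (Reg 29) (only parsing).
Local Notation Rlprod := (Reg 30) (only parsing).
Local Notation Rnewprod := (Reg 31) (only parsing).

Definition write_table : seq stmt :=
  [seq Store (Cst (regs + j)) (Cst (nth 0 table j)) | j <- iota 0 (size table)].

(* [Roldtot] is 0 on the first run and [Rtot] on all later ones, so that the
   array allocated here has length [Rtot] on the first run and 0 later. *)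
Definition setup : seq stmt :=
  [:: Let (inc (msb Rlen));
      Let (Rpos ⊖ Cst 1);
      Let (Rp ⊙ Rbsz);
      Let (Rp ⊘ Rbsz);
      Let ((Rlen ⊘ Rbsz) ⊕ Cst 2);
      Let (Rn1 ≪ Cst 3);
      New (Rtot ≫ Roldtot);
      Assign 3 Rtot;
      Let (Cst base ⊕ Rk);
      Let (Radr0 ⊕ Rn1);
      Let (Radr1 ⊕ Rn1);
      Let (Radr2 ⊕ Rn1);
      Let (Radr3 ⊕ Rn1);
      Let (Radr4 ⊕ Rn1)].

(** [Rones] minus a mask is the set of gaps; reducing modulo the bit of [t] keeps those on one side
    of [t]. In the reversed mask index [j] sits at bit B + 1 - j, so the next gap also becomes a
    most significant bit. [Rp ⊖ Ro] is the start k * B of the block, obtained without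
    multiplication. *)
Definition update_block : seq stmt :=
  [:: Let ((Cst 1 ≪ (Rbsz ⊕ Cst 2)) ⊖ Cst 1);
      Let (inc Ro);
      Let (Cst 1 ≪ Rt);
      Let (Cst 1 ≪ (inc Rbsz ⊖ Rt));
      Let (msb ((Rones ⊖ Fetch Radr0) ⊙ Rbit));
      Let (inc Rbsz ⊖ msb ((Rones ⊖ Fetch Radr1) ⊙ Rrbit));
      Let (digit_expr (Fetch Radr2) Rl);
      Let (digit_expr (Fetch Radr2) Rt);
      Let (mul_expr Rel (letter_expr Rletter));
      Let (mul_expr Rprod1 Ret);
      Store Radr2
        ((Fetch Radr2 ⊖ (Rel ≪ (Rl ≪ Cst beta))) ⊕ (Rprod ≪ (Rl ≪ Cst beta)));
      Store Radr0 (Fetch Radr0 ⊕ Rbit);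
      Store Radr1 (Fetch Radr1 ⊕ Rrbit);
      Let (Op2 OpLt Rl
        (Op2 OpOr (Op2 OpLt Rlen ((Rp ⊖ Ro) ⊕ Rr)) (Op2 OpLt Rbsz Rr)))].

(** The addresses belong to the boundary in front of block [k]; [inc] moves to the one behind it.
    The verdict is rewritten whenever a block becomes full, which the last triple always causes. *)
Definition update_runs : seq stmt :=
  [:: Let (Fetch Radr3);
      Let (Fetch (inc Radr4));
      Let (inc (Rlrun ⊕ Rrrun));
      Let (mul_expr (Fetch (Radr5 ⊖ Rlrun)) Rprod);
      Let (mul_expr Rlprod (Fetch (inc Radr5)));
      Store (Radr4 ⊖ Rlrun) Rrun;
      Store (inc Radr3 ⊕ Rrrun) Rrun;
      Store (Radr5 ⊖ Rlrun) Rnewprod;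
      Assign 0 (acc_expr (Fetch (Radr5 ⊖ Rk)))].

(** 4 counts the three inputs and the persistent total; 27 adds the 23 values bound in [setup] and
    [update_block]. *)
Definition first_part : seq instr := compile 4 (write_table ++ setup ++ update_block).
Definition second_part : seq instr := compile 27 update_runs.

(** [init] adds the three input cells to the scratch space, so that the allocated arrays begin
    exactly at [base]. *)
Definition algorithm : program :=
  Program (base - 3)
    (first_part ++ Jz Risfull (size first_part + size second_part).+1
     :: second_part ++ [:: Halt]).

(** The summand [2 * b] pays for the digits, since (B + 1) b <= 2 b B. A word has c B bits and there
    are about n / B cells per array, so B cancels in the space bound. *)
Lemma program_size_bounds c n : 0 < n -> base + 2 * b + 30 <= c ->
  let B := (trunc_log 2 n).+1 in let W := word_size c n in
  [/\ base + (n %/ B + 2) * 8 < 2 ^ W, 2 ^ B.+2 < 2 ^ W, D ^ B.+1 <= 2 ^ W,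
      B.+1 * b < 2 ^ W & (base + (n %/ B + 2) * 8) * W <= c * (base + 24) * n].
Proof.
move=> n_gt0 lec B W; have b_gt0 : 0 < b by rewrite expn_gt0.
have EW : W = c * B by [].
have leBn : B <= n by apply: leq_trans (trunc_logP (ltnSn 1) n_gt0); apply: ltn_expl.
have ltn : n < 2 ^ B by apply: trunc_log_ltn.
have B_gt0 : 0 < B by [].
have ltB : B.+1 * b < W by rewrite EW; nia.
have leW : c.-1 + B <= W by rewrite EW; nia.
have ltc : c.-1 < 2 ^ c.-1 by apply: ltn_expl.
have pW : 2 ^ c.-1 * 2 ^ B <= 2 ^ W by rewrite -expnD leq_exp2l.
have leq_nB : n %/ B <= n by apply: leq_div.
split.
- apply: leq_trans pW; apply: leq_trans (leq_mul ltc ltn); nia.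
- by rewrite ltn_exp2l // EW; nia.
- by rewrite -expnM leq_exp2l // mulnC ltnW.
- by apply: ltn_trans ltB (ltn_expl _ _).
have : n %/ B * B <= n by apply: leq_divM.
rewrite EW; move: (n %/ B) leq_nB => q _ leqB.
rewrite mulnCA -mulnA leq_mul2l; apply/orP; right.
have leBnb : base * B <= base * n by rewrite leq_mul2l leBn orbT.
(* Here 24 is 8 + 16: the arrays contribute 8 (n / B + 2) B <= 8 n + 16 B, and B <= n. *)
by move: leqB leBn leBnb; clear; lia.
Qed.

Hypothesis phi_lt : forall u, phi u < D.
Hypothesis mul_lt : forall x y, mul x y < D.
Hypothesis phi0 : phi [::] = 0.
Hypothesis phiM : {morph phi : u v / u ++ v >-> mul u v}.

Definition table_inv (h : nat -> nat) :=
  forall j, j < size table -> h (regs + j) = nth 0 table j.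

Lemma table_lt j : nth 0 table j < D.
Proof.
case: (ltnP j (size table)) => [|lej]; last by rewrite nth_default // expn_gt0.
move=> /(mem_nth 0); rewrite !mem_cat => /or3P[] /mapP[x _ ->] //.
by rewrite (leq_ltn_trans (leq_b1 _)) // -(expn0 2) ltn_exp2l // expn_gt0.
Qed.

Section Run.
Variables (W n B : nat) (w : n.-tuple Sigma).
Hypothesis n_gt0 : 0 < n.
Hypothesis B_def : B = (trunc_log 2 n).+1.
Hypothesis memory_fits : base + (n %/ B + 2) * 8 < 2 ^ W.
Hypothesis mask_fits : 2 ^ B.+2 < 2 ^ W.
Hypothesis digits_fit : D ^ B.+1 <= 2 ^ W.
Hypothesis shift_fits : B.+1 * b < 2 ^ W.

Let n_fits : n + B.+1 < 2 ^ W.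
Proof.
have ltn : n < 2 ^ B by rewrite B_def trunc_log_ltn.
have ltB : B < 2 ^ B by apply: ltn_expl.
by apply: ltn_trans mask_fits; rewrite !expnS; lia.
Qed.

Let b_gt0 : 0 < b. Proof. by rewrite expn_gt0. Qed.

Let D_lt : D < 2 ^ W.
Proof.
apply: leq_trans digits_fit; rewrite -{1}(expn1 D) ltn_exp2l ?B_def //.
by rewrite -(expn0 2) ltn_exp2l.
Qed.

Lemma wp_write_table l env h tp Q : size env + 2 <= regs -> base <= tp ->
  (forall h', table_inv h' -> (forall x, base <= x -> h' x = h x) ->
     wp W l env h' tp Q) ->
  wp W (write_table ++ l) env h tp Q.
Proof.
move=> ltenv letp; rewrite /write_table /table_inv.
have: size table <= size table by [].
(* Induction on the number of stores, the last one being moved into [l]; only the bound keeps the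
   true size of the table. *)
elim: {1 3 4}(size table) l => [|m IH] l lem Hl; first exact: Hl.
rewrite -addn1 iotaD map_cat -catA add0n; apply: IH => [|h1 Hh1 Eh1]; first by lia.
have leD := ltnW D_lt.
have lem' : regs + m < base by rewrite ltn_add2l.
apply: (wp_store (x := regs + m) (v := nth 0 table m)) => //.
- by apply: eval_cst; apply: ltn_trans lem' (leq_ltn_trans _ memory_fits);
  apply: leq_addr.
- by apply: eval_cst; apply: leq_trans leD; apply: table_lt.
- by rewrite leq_addr; apply: leq_trans letp.
apply: Hl => [j ltj|x lex]; rewrite /upd.
  rewrite eqn_add2l; case: eqP => [-> //|nej]; apply: Hh1; lia.
by rewrite gtn_eqF ?Eh1 //; apply: leq_trans lex.
Qed.

Let n1 := n %/ B + 2.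
Let tot := n1 * 2 ^ 3.
Let addr i k := base + i * n1 + k.

Let B_gt0 : 0 < B. Proof. by rewrite B_def. Qed.

Lemma base_lt : base < 2 ^ W.
Proof. by apply: leq_ltn_trans memory_fits; apply: leq_addr. Qed.

Lemma addr_lt i x : i < 6 -> x < n1 -> addr i x < base + tot.
Proof.
move=> lti ltx; rewrite /addr /tot -addnA ltn_add2l (mulnC n1).
apply: leq_trans (_ : i.+1 * n1 <= _); first by rewrite mulSn addnC ltn_add2r.
by rewrite leq_mul2r (leq_trans lti) ?orbT.
Qed.

Lemma addr_ltn i i' x y : i < i' -> x < n1 -> addr i x < addr i' y.
Proof.
move=> lti ltx; rewrite /addr -!(addnA base) ltn_add2l.
apply: leq_trans (leq_addr _ _); apply: leq_trans (_ : i.+1 * n1 <= _).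
  by rewrite mulSn (addnC n1) ltn_add2l.
by rewrite leq_mul2r lti orbT.
Qed.

Lemma addr_ltW i x : i < 6 -> x < n1 -> addr i x < 2 ^ W.
Proof.
by move=> lti ltx; apply: ltn_trans (addr_lt lti ltx) _; apply: memory_fits.
Qed.

Section Tables.
Variables (env : seq nat) (h : nat -> nat) (tp : nat).
Hypotheses (h_table : table_inv h) (letp : base <= tp).
Notation ev e v := (eval W env h tp e = Some (v : nat)).

Lemma eval_table j e : ev e (regs + j) -> j < size table -> ev (Fetch e) (nth 0 table j).
Proof.
move=> Ee ltj; apply: (eval_fetch Ee); rewrite ?h_table //.
  by rewrite leq_addr; apply: leq_trans letp; rewrite ltn_add2l.
by apply: leq_trans (ltnW D_lt); apply: table_lt.
Qed.

Lemma eval_mul e1 e2 x y : ev e1 x -> ev e2 y -> x < D -> y < D ->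
  ev (mul_expr e1 e2) (mul x y).
Proof.
move=> E1 E2 ltx lty; rewrite -(nth_table_mul ltx lty).
have ltxy : x * D + y < D * D by nia.
have ltxyW : regs + (x * D + y) < 2 ^ W.
  by apply: leq_ltn_trans base_lt; rewrite leq_add2l size_table; lia.
apply: eval_table; last by rewrite size_table; lia.
apply: eval_add => //; first by apply: eval_cst; lia.
apply: eval_add => //; last by lia.
apply: eval_shl => //; last by rewrite -/D; lia.
by apply: eval_cst; apply: leq_trans (ltnW D_lt); apply: ltn_expl.
Qed.

Lemma table_addr_lt j : j < size table -> regs + j < 2 ^ W.
Proof. by move=> ltj; apply: ltn_trans base_lt; rewrite ltn_add2l. Qed.

Lemma eval_letter e a : ev e (enum_rank a) -> ev (letter_expr e) (phi [:: a]).
Proof.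
move=> Ee; rewrite -nth_table_letter.
have lta : D * D + enum_rank a < size table.
  by rewrite size_table -addnA ltn_add2l ltn_addr // ltn_ord.
apply: eval_table => //; rewrite addnA; apply: eval_add => //.
  by apply: eval_cst; apply: table_addr_lt; apply: leq_ltn_trans lta; apply: leq_addr.
by rewrite -addnA table_addr_lt.
Qed.

Lemma eval_acc e x : ev e x -> x < D -> ev (acc_expr e) (acc x).
Proof.
move=> Ee ltx; rewrite -nth_table_acc //.
have lta : D * D + #|Sigma| + x < size table by rewrite size_table ltn_add2l.
apply: eval_table => //; rewrite (addnA regs _ x); apply: eval_add => //.
  by apply: eval_cst; apply: table_addr_lt; apply: leq_ltn_trans lta; apply: leq_addr.
by rewrite -addnA table_addr_lt.
Qed.

End Tables.

Lemma eval_digit env h tp (E J : expr) x m (e : nat -> nat) j :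
  (forall i, e i < D) -> j < m -> m <= B.+1 -> \sum_(i < m) e i * D ^ i = x ->
  eval W env h tp E = Some x ->
  eval W env h tp J = Some j -> eval W env h tp (digit_expr E J) = Some (e j).
Proof.
move=> lte ltj lem Ex EE EJ; rewrite -(sum_digits_nth lte ltj) Ex -expnM (mulnC b).
apply: eval_modn; last by rewrite expn_gt0.
  apply: eval_shr => //; apply: eval_shl => //.
    apply: eval_cst; apply: ltn_trans shift_fits.
    by apply: leq_trans (leq_pmull b (ltn0Sn B)); apply: ltn_expl.
  apply: leq_ltn_trans shift_fits; rewrite leq_mul2r.
  by rewrite (leq_trans (ltnW ltj)) ?orbT.
by apply: eval_cst; apply: D_lt.
Qed.

Ltac ev :=
  lazymatch goal with
  | |- eval _ _ _ _ (mul_expr _ _) = _ =>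
      eapply eval_mul; [done | done | ev | ev | try done | try done]
  | |- eval _ _ _ _ (letter_expr _) = _ => eapply eval_letter; [done | done | ev]
  | |- eval _ _ _ _ (acc_expr _) = _ => eapply eval_acc; [done | done | ev | try done]
  | |- eval _ _ _ _ (Reg _) = _ =>
      eapply eval_reg; [reflexivity | simpl; reflexivity | try done]
  | |- eval _ _ _ _ (Cst _) = _ => eapply eval_cst; try done
  | |- eval _ _ _ _ (Op1 OpInc _) = _ => eapply eval_inc; [ev | try done]
  | |- eval _ _ _ _ (Op1 OpMsb _) = _ => eapply eval_msb; [ev | try done]
  | |- eval _ _ _ _ (Op2 OpAdd _ _) = _ => eapply eval_add; [ev | ev | try done]
  | |- eval _ _ _ _ (Op2 OpSub _ _) = _ => eapply eval_sub; [ev | ev | try done]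
  | |- eval _ _ _ _ (Op2 OpDiv _ _) = _ => eapply eval_div; [ev | ev | try done]
  | |- eval _ _ _ _ (Op2 OpMod _ _) = _ => eapply eval_modn; [ev | ev | try done]
  | |- eval _ _ _ _ (Op2 OpShl _ _) = _ => eapply eval_shl; [ev | ev | try done]
  | |- eval _ _ _ _ (Op2 OpShr _ _) = _ => eapply eval_shr; [ev | ev]
  | |- eval _ _ _ _ (Op2 OpLt _ _) = _ => eapply eval_lt; [ev | ev | try done]
  | |- eval _ _ _ _ (Op2 OpOr _ _) = _ => eapply eval_or; [ev | ev | try done]
  | |- eval _ _ _ _ (Fetch _) = _ =>
      eapply eval_fetch; [ev | try done | first [eassumption | reflexivity | idtac] | try done]
  | _ => idtac
  end.

Ltac wstore X V :=
  eapply (@wp_store_eq _ _ X _ V); [ev | try done | ev | try done | done | | ].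

Ltac wlet X :=
  eapply (@wp_let_eq _ _ X); [ev | try done | done | rewrite [rcons _ _]/=].

Lemma B_le : B <= n.
Proof.
rewrite B_def; apply: leq_trans (trunc_logP (ltnSn 1) n_gt0).
exact: ltn_expl.
Qed.

(** The two cases are the first run and the later ones. On the first, allocation writes zeros over
    zeros, so in both cases the heap is unchanged pointwise. *)
Lemma wp_setup a p tp fl l h (Q : state -> Prop) : p < n -> a < 2 ^ W ->
  fl = 0 /\ tp = base /\ (forall x, base <= x -> h x = 0) \/
  fl = tot /\ tp = base + tot ->
  let k := p %/ B in
  (forall h', h' =1 h -> wp W l [:: a; p.+1; n; tot; B; p; p %% B; k; n1; tot;
      addr 0 k; addr 1 k; addr 2 k; addr 3 k; addr 4 k; addr 5 k] h' (base + tot) Q) ->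
  wp W (setup ++ l) [:: a; p.+1; n; fl] h tp Q.
Proof.
move=> ltp lta Hfl k Hl.
have memW : base + tot < 2 ^ W by [].
have base_ltW := base_lt.
have leB := B_le.
have ltk : k < n1 by apply: block_lt.
have totW : tot < 2 ^ W by lia.
have nW : n < 2 ^ W by apply: leq_ltn_trans n_fits; apply: leq_addr.
have BW : B < 2 ^ W by lia.
have lgW : (trunc_log 2 n).+1 < 2 ^ W by rewrite -B_def.
have pW : p < 2 ^ W by lia.
have pW1 : p.+1 < 2 ^ W by lia.
have kW : k < 2 ^ W by apply: leq_ltn_trans (leq_div _ _) pW.
have oW : p %% B < 2 ^ W by apply: leq_ltn_trans (leq_mod _ _) pW.
have cstW c : c < regs -> c < 2 ^ W.
  by move=> ltc; rewrite (ltn_trans ltc) // (leq_ltn_trans _ base_ltW) // leq_addr.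
have oneW := cstW 1 isT; have twoW := cstW 2 isT; have threeW := cstW 3 isT.
have a0 := addr_ltW (isT : 0 < 6) ltk.
have a1 := addr_ltW (isT : 1 < 6) ltk.
have a2 := addr_ltW (isT : 2 < 6) ltk.
have a3 := addr_ltW (isT : 3 < 6) ltk.
have a4 := addr_ltW (isT : 4 < 6) ltk.
have a5 := addr_ltW (isT : 5 < 6) ltk.
have n1W : n1 < 2 ^ W by rewrite /tot in totW; lia.
rewrite /setup.
wlet B.
wlet p; first by rewrite subn1.
wlet (p %% B).
wlet k.
wlet n1.
wlet tot.
have flW : fl < 2 ^ W by case: Hfl => [[-> _]|[-> _]]; lia.
have tot_shr : tot %/ 2 ^ tot = 0 by apply: divn_small; apply: ltn_expl.
apply: wp_new; [ev | done | | ].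
  case: Hfl => [[-> [-> _]]|[-> ->]]; first by rewrite divn1 ltnW.
  by rewrite tot_shr addn0 ltnW.
have [Etp Eh] : tp + tot %/ 2 ^ fl = base + tot /\
    zero_from h tp (tot %/ 2 ^ fl) =1 h.
  case: Hfl => [[-> [-> h0]]|[-> ->]].
    by rewrite divn1; split=> // x; rewrite /zero_from; case: ifP => // /andP[/h0].
  rewrite tot_shr addn0; split=> // x.
  by rewrite /zero_from addn0 ltnNge andbN.
rewrite Etp; apply: wp_assign; [ev | done | done | rewrite [set_nth _ _ _ _]/=].
have addrS i : addr i k + n1 = addr i.+1 k.
  by rewrite /addr mulSn addnAC addnA (addnAC base).
have addr0 : base + k = addr 0 k by rewrite /addr addn0.
wlet (addr 0 k); first by rewrite addr0.
wlet (addr 1 k); first by rewrite addrS.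
wlet (addr 2 k); first by rewrite addrS.
wlet (addr 3 k); first by rewrite addrS.
wlet (addr 4 k); first by rewrite addrS.
wlet (addr 5 k); first by rewrite addrS.
exact: Hl.
Qed.

Let f := factor phi w.

(** [m] is the value of the merged run; it is handed on as the value of the whole block only when
    the block has become full. *)
Lemma wp_update_block K p (x : Sigma) h (Q : state -> Prop) :
  let k := p %/ B in
  let K' : pred nat := fun q => (q == p) || K q in
  p < n -> ~~ K p -> f p p.+1 = phi [:: x] -> table_inv h ->
  heap_inv phi D base B w h K ->
  (forall r16 r17 r18 r19 r20 r21 r22 r23 r24 m h' s,
    table_inv h' ->
    (forall k0, k0 < n1 -> block_inv phi D base B w h' K' k0) ->
    (forall i y, 2 < i -> h' (addr i y) = h (addr i y)) ->
    (full n B K' k -> m = f (k * B) (k.+1 * B)) ->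
    holds [:: nat_of_ord (enum_rank x); p.+1; n; tot; B; p; p %% B; k; n1; tot;
      addr 0 k; addr 1 k; addr 2 k; addr 3 k; addr 4 k; addr 5 k;
      r16; r17; r18; r19; r20; r21; r22; r23; r24; m; full n B K' k : nat]
      h' (base + tot) s -> Q s) ->
  wp W update_block [:: nat_of_ord (enum_rank x); p.+1; n; tot; B; p; p %% B; k; n1; tot;
      addr 0 k; addr 1 k; addr 2 k; addr 3 k; addr 4 k; addr 5 k] h (base + tot) Q.
Proof.
move=> k K' ltp Kp fx h_table [hblocks hruns] HQ.
have ltk : k < n1 by apply: block_lt.
have [e [e0 e1 lte e2 e3]] := hblocks k ltk.
pose t := (p %% B).+1.
have Ep : p = k * B + t.-1 by apply: divn_eq.
have t_le : t <= B by rewrite ltn_mod.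
have gapt : gap B K k t := gap_position B Kp.
have [l al] : exists l, adj (gap B K k) l t by apply: adj_left.
have [|r ar ler] := @adj_right (gap B K k) t B.+1 gapt _ t_le.
  by rewrite /gap ltnSn orbT.
have ltl : l < B.+1 by case: al => ltl _ _ _; apply: leq_trans ltl _; apply: leqW.
have letp : base <= base + tot by apply: leq_addr.
have adrP i : i < 6 -> regs <= addr i k < base + tot.
  move=> lti; rewrite addr_lt // andbT /addr /base -!addnA; exact: leq_addr.
have adr0 := adrP 0 isT; have adr1 := adrP 1 isT; have adr2 := adrP 2 isT.
have a0W := addr_ltW (isT : 0 < 6) ltk.
have a1W := addr_ltW (isT : 1 < 6) ltk.
have a2W := addr_ltW (isT : 2 < 6) ltk.
have cstW c : c < regs -> c < 2 ^ W.
  by move=> ltc; rewrite (ltn_trans ltc) // (leq_ltn_trans _ base_lt) // leq_addr.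
have oneW := cstW 1 isT; have twoW := cstW 2 isT.
have n_ltW : n < 2 ^ W by apply: leq_ltn_trans n_fits; apply: leq_addr.
have BW : B.+2 < 2 ^ W by apply: leq_trans mask_fits; apply: ltnW; apply: ltn_expl.
have B2W : B + 2 < 2 ^ W by rewrite addn2.
have B1W : B.+1 < 2 ^ W := ltnW BW.
have BW0 : B < 2 ^ W := ltnW B1W.
have pow2W j : j < B.+2 -> 1 * 2 ^ j < 2 ^ W.
  by move=> ltj; rewrite mul1n; apply: ltn_trans mask_fits; rewrite ltn_exp2l.
have mskW : 1 * 2 ^ (B + 2) < 2 ^ W by rewrite mul1n addn2.
have tW : t < 2 ^ W by apply: leq_ltn_trans BW0.
have oW : p %% B < 2 ^ W by apply: ltnW tW.
have pW : p < 2 ^ W by apply: ltn_trans n_ltW.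
set hK := h (addr 0 k) in e0 *; set hR := h (addr 1 k) in e1 *.
pose F := (2 ^ B.+2).-1.
have hK_le : hK <= F by rewrite /F -e0 leq_addr.
have hR_le : hR <= F by rewrite /F -e1 leq_addr.
have F_lt : F < 2 ^ W by apply: leq_ltn_trans mask_fits; apply: leq_pred.
have hKW : hK < 2 ^ W by apply: leq_ltn_trans F_lt.
have hRW : hR < 2 ^ W by apply: leq_ltn_trans F_lt.
have hEW : h (addr 2 k) < 2 ^ W.
  by rewrite e2; apply: leq_trans digits_fit; apply: sum_digits_lt.
have pow_gt0 j : 0 < 2 ^ j by rewrite expn_gt0.
have [U_gt0 EU] : 0 < (F - hK) %% 2 ^ t /\ trunc_log 2 ((F - hK) %% 2 ^ t) = l.
  case: al => ltlt ul _ nl; apply: msb_sum_bits ltlt ul nl _; last by rewrite /F -e0 addKn.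
  by rewrite ltnW // ltnS leqW.
have [V_gt0 EV] : 0 < (F - hR) %% 2 ^ (B.+1 - t) /\
    trunc_log 2 ((F - hR) %% 2 ^ (B.+1 - t)) = B.+1 - r.
  pose u j := gap B K k (B.+1 - j).
  case: ar => ltr _ ur nr; apply: (@msb_sum_bits u B.+2).
  - by rewrite ltnW // ltnS leq_subr.
  - by apply: ltn_sub2l => //; apply: leq_trans ltr ler.
  - by rewrite /u subKn.
  - by move=> i lti; apply: nr; move: lti t_le ler; clear; lia.
  - by rewrite /F -e1 addKn.
have {}e2 := esym e2.
have bitW : 2 ^ t < 2 ^ W by rewrite -[2 ^ t]mul1n pow2W // ltnS leqW.
have rbitW : 2 ^ (B.+1 - t) < 2 ^ W by rewrite -[2 ^ _]mul1n pow2W // ltnS leq_subr.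
rewrite /update_block.
wlet F; [by rewrite mul1n expn_gt0 | by rewrite mul1n addn2 subn1 | ].
wlet t.
wlet (2 ^ t); [by rewrite mul1n | by rewrite mul1n | ].
wlet (2 ^ (B.+1 - t)); [by rewrite leqW | by rewrite mul1n | by rewrite mul1n | ].
wlet l.
wlet r; [by rewrite EV leq_subr | by rewrite EV subKn | ].
pose m := f (k * B + l) (k * B + r.-1).
have lt_tB : t < B.+1 by [].
have ltm : m < D by apply: phi_lt.
have Em : mul (mul (e l) (phi [:: x])) (e t) = m.
  by rewrite -fx (merge_value phi0 phiM n_gt0 B_gt0 ltp Kp al ar ler e3).
have lW : l < 2 ^ W by apply: ltn_trans B1W.
have rW : r < 2 ^ W by apply: leq_ltn_trans B1W.
have aW : enum_rank x < 2 ^ W.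
  apply: ltn_trans base_lt; rewrite /base size_table.
  by apply: leq_trans (ltn_ord _) _; rewrite (addnC (D * D)) -addnA addnCA leq_addr.
apply: (wp_let (v := e l)); [ | done | rewrite [rcons _ _]/=].
  by apply: (eval_digit lte ltl (leqnn _) e2); ev.
apply: (wp_let (v := e t)); [ | done | rewrite [rcons _ _]/=].
  by apply: (eval_digit lte lt_tB (leqnn _) e2); ev.
have eW j : e j < 2 ^ W by apply: ltn_trans (lte j) D_lt.
have m1W := ltn_trans (mul_lt (e l) (phi [:: x])) D_lt.
have mW : m < 2 ^ W by apply: ltn_trans ltm D_lt.
wlet (mul (e l) (phi [:: x])).
wlet m.
have El : 2 ^ (l * 2 ^ beta) = D ^ l by rewrite mulnC expnM.
have betaW : beta < 2 ^ W.
  apply: ltn_trans shift_fits; apply: leq_trans (leq_pmull b (ltn0Sn B)).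
  exact: ltn_expl.
have shW : l * 2 ^ beta < 2 ^ W.
  by apply: leq_ltn_trans shift_fits; rewrite leq_mul2r (ltnW ltl) orbT.
pose hE := h (addr 2 k) - e l * 2 ^ (l * 2 ^ beta) + m * 2 ^ (l * 2 ^ beta).
have sub_le : e l * 2 ^ (l * 2 ^ beta) <= h (addr 2 k).
  by rewrite El -e2; apply: digit_le_sum.
have elW : e l * 2 ^ (l * 2 ^ beta) < 2 ^ W by apply: leq_ltn_trans hEW.
(* The updated word is again a sum of digits below [D], which bounds it. *)
have newW : hE < 2 ^ W.
  pose e' j := if j == l then m else e j.
  have -> : hE = \sum_(j < B.+1) e' j * D ^ j.
    rewrite /hE El -e2 (sum_digits_upd D (e := e) (e' := e') ltl) /e' ?eqxx // => j.
    by move/negPf ->.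
  apply: leq_trans digits_fit; apply: sum_digits_lt => j; rewrite /e'.
  by case: eqP.
have mpW : m * 2 ^ (l * 2 ^ beta) < 2 ^ W.
  by apply: leq_ltn_trans newW; apply: leq_addl.
have neq01 : addr 0 k != addr 1 k by rewrite addr_eq.
have neq02 : addr 0 k != addr 2 k by rewrite addr_eq.
have neq12 : addr 1 k != addr 2 k by rewrite addr_eq.
wstore (addr 2 k) hE; first by [].
set h2 := upd _ _ _.
have h20 : h2 (addr 0 k) = hK by rewrite /h2 /upd (negPf neq02).
have KW : hK + 2 ^ t < 2 ^ W.
  pose u j := gap B K k j : nat; have ltt : t < B.+2 by rewrite ltnS leqW.
  apply: leq_ltn_trans F_lt; rewrite /F -e0 leq_add2l.
  by apply: leq_trans (digit_le_sum 2 u ltt); rewrite /u gapt mul1n.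
wstore (addr 0 k) (hK + 2 ^ t); first by [].
set h0 := upd _ _ _.
have h01 : h0 (addr 1 k) = hR.
  by rewrite /h0 /h2 /upd eq_sym (negPf neq01) (negPf neq12).
have RW : hR + 2 ^ (B.+1 - t) < 2 ^ W.
  pose u j := gap B K k (B.+1 - j) : nat.
  have ltt : B.+1 - t < B.+2 by rewrite ltnS leq_subr.
  apply: leq_ltn_trans F_lt; rewrite /F -e1 leq_add2l.
  by apply: leq_trans (digit_le_sum 2 u ltt); rewrite /u subKn ?leqW // gapt mul1n.
wstore (addr 1 k) (hR + 2 ^ (B.+1 - t)); first by [].
set h1 := upd _ _ _.
have Ekb : p - p %% B = k * B by rewrite [X in X - _](divn_eq p B) addnK.
have kbW : p - p %% B + r < 2 ^ W.
  apply: leq_ltn_trans n_fits; apply: leq_add ler.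
  by apply: leq_trans (leq_subr _ _) (ltnW ltp).
have Efull : full n B K' k = (l < (n < k * B + r) || (B < r)) :=
  full_step n_gt0 B_gt0 ltp Kp al ar ler.
wlet (full n B K' k : nat); [exact: leq_mod | by rewrite Efull Ekb | ].
apply: wp_nil => s hs; apply: (HQ _ _ _ _ _ _ _ _ _ _ _ _ _ _ _ _ hs).
- move=> j ltj; have ltjb : regs + j < base by rewrite ltn_add2l.
  have neq i : regs + j == addr i k = false.
    by apply: ltn_eqF; apply: leq_trans ltjb _; rewrite /addr -addnA leq_addr.
  by rewrite /h1 /h0 /h2 /upd !neq h_table.
- move=> k0 ltk0; case: (eqVneq k0 k) => [->|nek].
    apply: (block_step (h' := h1) phi_lt n_gt0 B_gt0 ltp Kp al ar ler e0 e1 lte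
      (esym e2) e3 _ _ (erefl m)).
    + by rewrite /h1 /h0 /upd (negPf neq01) eqxx.
    + by rewrite /h1 /upd eqxx.
    by rewrite /h1 /h0 /h2 /upd eq_sym (negPf neq12) eq_sym (negPf neq02) eqxx /hE El.
  apply: (block_inv_eq n_gt0 B_gt0 ltp Kp nek _ (hblocks _ ltk0)) => i lti.
  by rewrite /h1 /h0 /h2 /upd !addr_eq // (negPf nek) !andbF.
- move=> i y lti.
  have neq i' : i' < 3 -> addr i y == addr i' k = false.
    by move=> lti'; apply: gtn_eqF; apply: addr_ltn; rewrite ?(leq_trans lti').
  by rewrite /h1 /h0 /h2 /upd !neq.
move=> F1; move: Efull; rewrite F1 => /esym lf.
have l0 : l = 0 by case: (_ || _) lf; case: (l).
(* Either the word ends inside the block and both right ends are clipped to [n], or [r] is the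
   sentinel [B.+1]. *)
rewrite /m l0 addn0; move: lf; rewrite l0 lt0b => /orP[lenr|ltBr].
  apply: factor_clip.
  - by move: lenr ar => + [ltr _ _ _]; case: (r) ltr => // r' _; rewrite addnS.
  rewrite mulSn addnC; apply: leq_trans (_ : k * B + r.-1 <= _).
    by move: lenr ar => + [ltr _ _ _]; case: (r) ltr => // r' _; rewrite addnS.
  by rewrite leq_add2l -ltnS; case: ar => ltr _ _ _; rewrite prednK // (leq_trans _ ltr).
have -> : r = B.+1 by apply/eqP; rewrite eqn_leq ler.
by rewrite mulSn addnC.
Qed.


Definition after_run (K : pred nat) s :=
  [/\ top s = base + tot, cells s 3 = tot
    & heap_inv phi D base B w (cells s) K].

Lemma wp_update_runs K p h m (Q : state -> Prop)
    r0 r1 r2 r4 r5 r6 r8 r9 r10 r11 r12 r16 r17 r18 r19 r20 r21 r22 r23 r24 r26 :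
  let k := p %/ B in
  let K' : pred nat := fun q => (q == p) || K q in
  p < n -> ~~ K p -> full n B K' k -> m = f (k * B) (k.+1 * B) -> table_inv h ->
  (forall k0, k0 < n1 -> block_inv phi D base B w h K' k0) ->
  runs_inv phi base B w h K ->
  (forall s, after_run K' s -> cells s 0 = acc (cells s (addr 5 0)) -> Q s) ->
  wp W update_runs
    [:: r0; r1; r2; tot; r4; r5; r6; k; r8; r9; r10; r11; r12;
        addr 3 k; addr 4 k; addr 5 k;
        r16; r17; r18; r19; r20; r21; r22; r23; r24; m; r26] h (base + tot) Q.
Proof.
move=> k K' ltp Kp F Em h_table hblocks hruns HQ.
have ltk : k < n1 by apply: block_lt.
pose nb := n.-1 %/ B + 1.
have lenb : nb < n1 by apply: nblocks_lt.
have ltkb : k < nb by apply: (block_lt_nblocks n_gt0 B_gt0 ltp Kp).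
have gapk : block_gap n B K k.+1.
  by rewrite /block_gap /= not_full ?orbT.
have [l al] : exists l, adj (block_gap n B K) l k.+1 by apply: adj_left.
have [||r ar ler] := @adj_right (block_gap n B K) k.+1 nb.+1 gapk.
- by rewrite /block_gap ltnSn orbT.
- by [].
have lelk : l <= k by case: al.
have ltkr : k.+1 < r by case: ar.
have ltr1 : r.-1 < n1 by move: ler lenb ltkr; clear; lia.
have ltl : l < n1 by apply: leq_ltn_trans ltk.
have ltk1 : k.+1 < n1 by apply: leq_ltn_trans lenb.
have [|/= hl3 _ hl5] := hruns l k.+1 al; first by apply: ltnW.
have [_ hr4 hr5] := hruns k.+1 r ar ler.
have letp : base <= base + tot by apply: leq_addr.
have adrP i x : i < 6 -> x < n1 -> regs <= addr i x < base + tot.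
  by move=> lti ltx; rewrite addr_lt // andbT /addr /base -!addnA leq_addr.
have inc_adr i : (addr i k).+1 = addr i k.+1 by rewrite /addr addnS.
have sub_adr i x : x <= k -> addr i k - (k - x) = addr i x.
  by move=> lex; rewrite /addr -[in X in X - _](subnK lex) addnCA addKn.
have sub_le i x : k - x <= addr i k by apply: leq_trans (leq_subr _ _) (leq_addl _ _).
have fW i j : f i j < 2 ^ W by apply: ltn_trans (phi_lt _) D_lt.
have nW x : x <= n1 -> x < 2 ^ W.
  move=> lex; apply: leq_ltn_trans memory_fits; apply: leq_trans lex _.
  by apply: leq_trans (leq_addl _ _); apply: leq_pmulr.
have adrW i x : i < 6 -> x < n1 -> addr i x < 2 ^ W by apply: addr_ltW.
have vl3 : h (addr 3 k) = k - l := hl3.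
have vr4 : h (addr 4 k).+1 = r.-1 - k.+1 by rewrite inc_adr.
have vl5 : h (addr 5 k - (k - l)) = f (l * B) (k * B) by rewrite sub_adr.
have vr5 : h (addr 5 k).+1 = f (k.+1 * B) (r.-1 * B) by rewrite inc_adr.
have a3W := adrW 3 _ isT ltk; have a4W := adrW 4 _ isT ltk; have a5W := adrW 5 _ isT ltk.
have b3W : (addr 3 k).+1 < 2 ^ W by rewrite inc_adr adrW.
have b4W : (addr 4 k).+1 < 2 ^ W by rewrite inc_adr adrW.
have b5W : (addr 5 k).+1 < 2 ^ W by rewrite inc_adr adrW.
have a3P := adrP 3 _ isT ltk; have a5P := adrP 5 _ isT ltl.
have b4P : regs <= (addr 4 k).+1 < base + tot by rewrite inc_adr adrP.
have b5P : regs <= (addr 5 k).+1 < base + tot by rewrite inc_adr adrP.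
have c5P : regs <= addr 5 k - (k - l) < base + tot by rewrite sub_adr.
have klW : k - l < 2 ^ W by apply: nW; apply: leq_trans (leq_subr _ _) (ltnW ltk).
have rkW : r.-1 - k.+1 < 2 ^ W by apply: nW; apply: leq_trans (leq_subr _ _) (ltnW ltr1).
have rlW : r.-1 - l < 2 ^ W by apply: nW; apply: leq_trans (leq_subr _ _) (ltnW ltr1).
have Erl : (k - l + (r.-1 - k.+1)).+1 = r.-1 - l.
  by move: lelk ltkr; clear; lia.
have rlW1 : (k - l + (r.-1 - k.+1)).+1 < 2 ^ W by rewrite Erl.
have rlW0 := ltnW rlW1.
have mW : m < 2 ^ W by rewrite Em.
have kW : k < 2 ^ W by apply: nW; apply: ltnW.
have f1D : f (l * B) (k * B) < D by apply: phi_lt.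
have f2D : f (k.+1 * B) (r.-1 * B) < D by apply: phi_lt.
have mD : m < D by rewrite Em; apply: phi_lt.
have pW : mul (f (l * B) (k * B)) m < 2 ^ W by apply: ltn_trans (mul_lt _ _) D_lt.
have Ef : mul (mul (f (l * B) (k * B)) m) (f (k.+1 * B) (r.-1 * B)) =
    f (l * B) (r.-1 * B).
  have ltk1r : k.+1 <= r.-1 by move: ltkr; clear; lia.
  rewrite Em -!factor_cat ?leq_mul2r ?lelk ?leqnSn ?ltk1r ?orbT //.
  by rewrite (leq_trans lelk (leqnSn k)) orbT.
rewrite /update_runs.
wlet (k - l).
wlet (r.-1 - k.+1).
wlet (r.-1 - l).
wlet (mul (f (l * B) (k * B)) m).
wlet (f (l * B) (r.-1 * B)).
wstore (addr 4 l) (r.-1 - l); [by rewrite sub_adr | by rewrite adrP | ].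
have E3 : (addr 3 k).+1 + (r.-1 - k.+1) = addr 3 r.-1.
  have ltk1r : k.+1 <= r.-1 by move: ltkr; clear; lia.
  by rewrite inc_adr /addr -addnA subnKC.
have c3W : (addr 3 k).+1 + (r.-1 - k.+1) < 2 ^ W by rewrite E3 adrW.
wstore (addr 3 r.-1) (r.-1 - l); [by rewrite adrP | ].
wstore (addr 5 l) (f (l * B) (r.-1 * B)); [by rewrite sub_adr | by rewrite adrP | ].
set h' := upd _ _ _.
have eqA i i' x y : x < n1 -> y < n1 -> (addr i x == addr i' y) = (i == i') && (x == y).
  exact: addr_eq.
have hr' : runs_inv phi base B w h' K'.
  apply: (runs_step phi0 n_gt0 B_gt0 ltp Kp F al ar ler _ hruns) => y lty.
  by rewrite /h' /upd !eqA //=; split; case: eqP => // ->.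
have hb' k0 : k0 < n1 -> block_inv phi D base B w h' K' k0.
  move=> ltk0; have [e He] := hblocks k0 ltk0; exists e.
  by rewrite /h' /upd !eqA.
have h'_table : table_inv h'.
  move=> j ltj; have ltjb : regs + j < base by rewrite ltn_add2l.
  have neq i y : regs + j == addr i y = false.
    by apply: ltn_eqF; apply: leq_trans ltjb _; rewrite /addr -addnA leq_addr.
  by rewrite /h' /upd !neq h_table.
(* Boundary 0 is always a gap, so its cell holds the value of some factor: the acceptance table is
   read within range even while the word is incomplete. *)
have [r0' ar0] : exists r0', h' (addr 5 0) = f (0 * B) (r0'.-1 * B).
  have [|||r' ar' ler'] // := @adj_right (block_gap n B K') 0 nb.+1.
    by rewrite /block_gap ltnSn orbT.
  by exists r'; have [] := hr' 0 r' ar' ler'.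
have v0D : h' (addr 5 0) < D by rewrite ar0; apply: phi_lt.
have v0W := ltn_trans v0D D_lt.
have E50 : addr 5 k - k = addr 5 0 by rewrite /addr addn0 addnK.
have v50 : h' (addr 5 k - k) = h' (addr 5 0) by rewrite E50.
have n1_gt0 : 0 < n1 by rewrite /n1 addn2.
have d5P : regs <= addr 5 k - k < base + tot by rewrite E50 adrP.
have lek5 : k <= addr 5 k by apply: leq_addl.
apply: wp_assign; [ev | done | done | rewrite [set_nth _ _ _ _]/=].
apply: wp_nil => s [Etop _ Ereg Eheap]; apply: HQ; last first.
  by rewrite (Ereg 0) // Eheap //; case/andP: (adrP 5 0 isT n1_gt0).
split=> //; first exact: (Ereg 3).
apply: heap_inv_ext (conj hb' hr') => x lex; apply: Eheap.
by apply: leq_trans lex; apply: leq_addr.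
Qed.

(** * Correctness of one run and of the whole stream *)

Definition before_run (K : pred nat) s :=
  after_run K s \/
  [/\ K = pred0, top s = base, cells s 3 = 0 & forall x, base <= x -> cells s x = 0].

Let code_eq : code algorithm =
  first_part ++ Jz Risfull (size first_part + size second_part).+1
     :: second_part ++ [:: Halt].
Proof. by []. Qed.

Lemma letter_lt (a : Sigma) : enum_rank a < 2 ^ W.
Proof.
apply: ltn_trans base_lt; rewrite /base size_table.
by apply: leq_trans (ltn_ord _) _; rewrite (addnC (D * D)) -addnA addnCA leq_addr.
Qed.

(** The only jump goes forward, so the length of the code, which is independent of [n], bounds the
    number of steps. *)
Lemma run_algorithm K p (x : Sigma) s :
  let k := p %/ B in
  let K' : pred nat := fun q => (q == p) || K q in
  p < n -> ~~ K p -> f p p.+1 = phi [:: x] -> before_run K s ->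
  cells s 0 = enum_rank x -> cells s 1 = p.+1 -> cells s 2 = n ->
  exists s', [/\ run W (code algorithm) (size (code algorithm)) 0 s = Some s',
    after_run K' s' & full n B K' k -> cells s' 0 = acc (cells s' (addr 5 0))].
Proof.
move=> k K' ltp Kp fx Hs c0 c1 c2.
set T := size (code algorithm).
have ET : T = size first_part + (size second_part).+2.
  rewrite /T code_eq; move: first_part second_part => c1' c2'.
  by rewrite size_cat /= size_cat addn1.
pose Q s' := exists s2, [/\
  run W (code algorithm) (size second_part).+2 (size first_part) s' = Some s2,
  after_run K' s2 & full n B K' k -> cells s2 0 = acc (cells s2 (addr 5 0))].
have aW : enum_rank x < 2 ^ W.
  exact: letter_lt.
have regs_base : regs <= base by apply: leq_addr.
have base_top : base <= top s by case: Hs => [[->]|[_ ->]]; rewrite ?leq_addr.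
have hs : holds [:: nat_of_ord (enum_rank x); p.+1; n; cells s 3] (cells s) (top s) s.
  by split=> //; [apply: leq_trans base_top | case=> [|[|[|[|]]]]].
suff Hwp : wp W (write_table ++ setup ++ update_block)
    [:: nat_of_ord (enum_rank x); p.+1; n; cells s 3] (cells s) (top s) Q.
  have [s1 E1 [s2 [E2 H1 H2]]] := Hwp s hs; exists s2; split=> //.
  have := @run_execs W [::] first_part
    (Jz Risfull (size first_part + size second_part).+1 :: second_part ++ [:: Halt])
    (size second_part).+2 s s1 E1.
  by rewrite cat0s -code_eq -ET => ->.
apply: wp_write_table => // h1 h1_table Eh1.
have Hsetup : cells s 3 = 0 /\ top s = base /\ (forall y, base <= y -> h1 y = 0) \/
    cells s 3 = tot /\ top s = base + tot.
  case: Hs => [[-> -> _]|[_ -> -> s0]]; [by right | left].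
  by split=> //; split=> // y ley; rewrite Eh1 ?s0.
have inv1 : heap_inv phi D base B w h1 K.
  case: Hs => [[_ _ Hh]|[K0 _ _ s0]]; first exact: heap_inv_ext Hh.
  by rewrite K0; apply: heap_inv0 => // y ley; rewrite Eh1 ?s0.
apply: (wp_setup ltp aW Hsetup) => h2 Eh2; rewrite -/k.
have h2_table : table_inv h2 by move=> j ltj; rewrite Eh2 h1_table.
have inv2 : heap_inv phi D base B w h2 K by apply: heap_inv_ext inv1 => y _.
apply: (wp_update_block ltp Kp fx h2_table inv2).
move=> r16 r17 r18 r19 r20 r21 r22 r23 r24 m h3 s3 h3_table hblocks h3_eq Em hs3.
have hruns : runs_inv phi base B w h3 K.
  by case: inv2 => _ H j j' aj lej; rewrite !h3_eq //; apply: H.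
have onth_jz : onth (code algorithm) (size first_part) =
    Some (Jz Risfull (size first_part + size second_part).+1).
  by rewrite code_eq onthE map_cat nth_cat size_map ltnn subnn.
have onth_halt : onth (code algorithm) (size first_part + size second_part).+1 = Some Halt.
  rewrite code_eq; move: first_part second_part => c1' c2'.
  rewrite onthE map_cat nth_cat size_map -addnS ltnNge leq_addr /= addKn /=.
  by rewrite map_cat nth_cat size_map ltnn subnn.
have [Etop _ Ereg Eheap] := hs3.
have rd : read s3 Risfull = Some (full n B K' k : nat).
  by rewrite /read Etop (Ereg 26) // (leq_trans _ (leq_trans regs_base (leq_addr _ _))).
rewrite /Q (run_jz _ _ onth_jz rd).
case: (boolP (full n B K' k)) => F; last first.
  exists s3; split=> //; first by rewrite [_ == _]/= (run_halt _ _ _ onth_halt).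
  split=> //; first exact: (Ereg 3).
  have Hr := runs_inv_eq n_gt0 B_gt0 ltp Kp F (fun i y _ => erefl (h3 (addr i y))) hruns.
  apply: heap_inv_ext (conj hblocks Hr) => y ley; apply: Eheap.
  by apply: leq_trans ley.
have [//|s4 E4 [H4 H5]] := wp_update_runs
  (Q := fun s0 => after_run K' s0 /\ cells s0 0 = acc (cells s0 (addr 5 0)))
  ltp Kp F (Em F) h3_table hblocks hruns _ hs3.
exists s4; split=> //; rewrite [_ == _]/=.
have := @run_execs W (rcons first_part (Jz Risfull (size first_part + size second_part).+1))
  second_part [:: Halt] 1 s3 s4 E4.
rewrite cat_rcons -code_eq size_rcons addn1 => ->.
apply: run_halt; rewrite -onth_halt; congr onth.
by rewrite size_cat size_rcons addSn.
Qed.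

Definition stream_inv (K : pred nat) s :=
  before_run K s /\ ((forall q, q < n -> K q) -> cells s 0 = acc (phi w)).

Lemma receiveP K (i : 'I_n) s : before_run K s -> exists s', [/\
  receive W (tnth w i, i.+1, n) s = Some s', before_run K s',
  cells s' 0 = enum_rank (tnth w i), cells s' 1 = i.+1 & cells s' 2 = n].
Proof.
move=> Hs; have lt3 : 2 < base by [].
have base_top : base <= top s by case: Hs => [[->]|[_ ->]]; rewrite ?leq_addr.
have nW : n < 2 ^ W by apply: leq_ltn_trans n_fits; apply: leq_addr.
have lt2 := leq_trans lt3 base_top.
rewrite /receive /write (ltn_trans _ lt2) //= (ltn_trans _ lt2) //= lt2 /=.
eexists; split=> //=; last 3 first.
- by rewrite modn_small // letter_lt.
- by rewrite modn_small // (leq_ltn_trans (ltn_ord i)).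
- by rewrite modn_small.
case: Hs => [[E1 E2 Hh]|[-> E1 E2 s0]]; [left | right]; split=> //=.
move=> y ley; have lt2y := leq_trans lt3 ley.
by rewrite !gtn_eqF ?s0 // ltnW // ltnW.
Qed.

Lemma stream_step (K : pred nat) (i : 'I_n) s : ~~ K i -> stream_inv K s -> exists2 s',
  obind (run W (code algorithm) (size (code algorithm)) 0)
    (receive W (tnth w i, i.+1, n) s) = Some s' &
  stream_inv (fun q => (q == i :> nat) || K q) s'.
Proof.
move=> Ki [/(receiveP i)[s1 [-> Hs1 c0 c1 c2]] _].
have fi : f i i.+1 = phi [:: tnth w i] by apply: factor_letter.
have [s2 [E2 H1 H2]] := run_algorithm (ltn_ord i) Ki fi Hs1 c0 c1 c2.
exists s2 => //; split; first by left.
move=> KT; rewrite H2; last by apply/allP => q _; case: (ltnP q n) => // /KT.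
case: H1 => _ _ Hh.
by congr (nat_of_bool (acc _)); apply: (heap_inv_full phi0 n_gt0 B_gt0 Hh).
Qed.

Lemma stream_run (ps : seq 'I_n) (K : pred nat) s :
  uniq ps -> (forall i, i \in ps -> ~~ K i) -> stream_inv K s -> exists s' K',
  [/\ foldl (fun os x => obind (run W (code algorithm) (size (code algorithm)) 0)
        (obind (receive W x) os)) (Some s) [seq (tnth w i, i.+1, n) | i <- ps] = Some s',
      stream_inv K' s' & forall q, K q || (q \in [seq val i | i <- ps]) -> K' q].
Proof.
elim: ps K s => [|i ps IH] K s /=.
  by move=> _ _ Hs; exists s, K; split=> // q; rewrite orbF.
case/andP=> nips ups HK Hs.
have [|s1 -> Hs1] := @stream_step K i s _ Hs; first by apply: HK; rewrite inE eqxx.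
have [//|j jps|s2 [K2 [E2 Hs2 HK2]]] := IH _ s1 _ _ Hs1.
  rewrite negb_or HK ?inE ?jps ?orbT // andbT.
  by apply: contra nips => /eqP/val_inj <-.
exists s2, K2; split=> // q Hq; apply: HK2; move: Hq.
by rewrite inE orbCA orbA.
Qed.

(** Injectivity of [pi] makes each arriving position a gap at that moment; surjectivity leaves none
    unknown at the end. *)
Lemma stream_correct (pi : 'S_n) : exists2 s,
  run_stream W algorithm (size (code algorithm)) (out_of_order_stream w pi) = Some s &
  top s <= base + tot /\ (answer s <-> acc (phi w)).
Proof.
pose ps := [seq pi i | i <- enum 'I_n].
have Hinit : stream_inv pred0 (init algorithm).
  split; last by move=> /(_ 0 n_gt0).
  by right; split=> //=; rewrite subnKC.
have [||s [K [Es [Hs HC] HK]]] := @stream_run ps _ _ _ _ Hinit.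
- by rewrite map_inj_uniq ?enum_uniq //; apply: perm_inj.
- by [].
have -> : out_of_order_stream w pi = [seq (tnth w i, i.+1, n) | i <- ps].
  by rewrite -map_comp.
exists s => //; split; first by case: Hs => [[->]|[_ -> _ _]]; rewrite ?leq_addr.
rewrite /answer HC; first by rewrite eqb0 negbK.
move=> q ltq; apply: HK; rewrite /=; apply/mapP; exists (Ordinal ltq) => //.
by apply/mapP; exists (pi^-1 (Ordinal ltq))%g; rewrite ?mem_enum ?permKV.
Qed.

End Run.

End Program.

Theorem theorem2p1 (Sigma : finType) (L : seq Sigma -> Prop) (hL : regular L) :
  exists c0 : nat, forall c : nat, c0 <= c ->
  exists (P : program) (T S : nat),
  forall (n : nat) (w : n.-tuple Sigma) (pi : 'S_n), 0 < n ->
  exists s : state,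
    run_stream (word_size c n) P T (out_of_order_stream w pi) = Some s /\
    (answer s <-> L w) /\
    space_bits (word_size c n) s <= S * n.
Proof.
have [m [phi [mul [acc [phi0 phiM phi_ltm mul_ltm accP]]]]] := regular_morphism hL.
(* Choosing [beta] as [m] gives a base of the required form 2 ^ (2 ^ beta) above all codes. *)
have ltD : m < 2 ^ (2 ^ m) by apply: ltn_trans (ltn_expl m (ltnSn 1)) (ltn_expl _ _).
have phi_lt u := ltn_trans (phi_ltm u) ltD.
have mul_lt x y := ltn_trans (mul_ltm x y) ltD.
pose st := base phi mul acc m.
exists (st + 2 * 2 ^ m + 30) => c lec.
pose P := algorithm phi mul acc m.
exists P, (size (code P)), (c * (st + 24)) => n w pi n_gt0.
have [h1 h2 h3 h4 h5] := program_size_bounds n_gt0 lec.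
have [s -> [htop Hs]] :=
  stream_correct phi_lt mul_lt phi0 phiM w n_gt0 (erefl _) h1 h2 h3 h4 pi.
exists s; split=> //; split; first by rewrite accP.
by apply: leq_trans h5; rewrite /space_bits leq_mul2r htop orbT.
Qed.
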